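(* Let $n\in\mathbb{N}$ and $\theta>0$. Suppose $u\in\mathcal{D}_\theta$ and $v\in C^1_b(\overline{\mathbb{W}^n})$, and suppose there exist $a,c>0$ such that $|\nabla u(x)|\le ae^{-c|x|}$ for all $x\in\overline{\mathbb{W}^n}$. Then $$\int_{\overline{\mathbb{W}^n}}\Delta u(x)\,v(x)\,m^{(n)}_\theta(dx)=-(u,v)_\theta,$$ whenever these integrals are finite, where $$(u,v)_\theta=\sum_{\pi\in\Pi_n}\theta^{|\pi|-n}\Big(\prod_{\pi_\iota\in\pi}\frac1{|\pi_\iota|}\Big)\int_{\mathbb{W}^{|\pi|}}\nabla u_\pi\cdot\nabla v_\pi\,dx .$$
   Context: $\mathbb{W}^n=\{x\in\mathbb{R}^n: x_1>\dots>x_n\}$, $\overline{\mathbb{W}^n}=\{x: x_1\ge\dots\ge x_n\}$. $C^2_0(\overline{\mathbb{W}^n})$ is the set of $f:\overline{\mathbb{W}^n}\to\mathbb{R}$ having a $C^2$ extension to an open set containing $\overline{\mathbb{W}^n}$ with $f$ and all its first and second partial derivatives vanishing at infinity. $C^1_b(\overline{\mathbb{W}^n})$: functions with a $C^1$ extension to an open neighbourhood, bounded together with their first derivatives on $\overline{\mathbb{W}^n}$. $\Pi_n$ is the set of ordered partitions $\pi=(\pi_1,\dots,\pi_{|\pi|})$ of $\{1,\dots,n\}$ into nonempty blocks such that $a\in\pi_j$, $b\in\pi_l$, $j<l$ imply $a<b$. $\mathbb{W}^n_\pi=\{x\in\overline{\mathbb{W}^n}: x_\alpha=x_\beta \iff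 \alpha,\beta \text{ lie in the same block of }\pi\}$; $I^\pi:\mathbb{W}^n_\pi\to\mathbb{W}^{|\pi|}$ is the bijection $I^\pi(x)=(x_{p_1},\dots,x_{p_{|\pi|}})$, $p_i\in\pi_i$; $\lambda^\pi$ is the image of Lebesgue measure on $\mathbb{W}^{|\pi|}$ under $(I^\pi)^{-1}$, as a Borel measure on $\overline{\mathbb{W}^n}$; $m^{(n)}_\theta=\sum_{\pi\in\Pi_n}\theta^{|\pi|-n}\big(\prod_{\pi_\iota\in\pi}\frac1{|\pi_\iota|}\big)\lambda^\pi$. For $u:\overline{\mathbb{W}^n}\to\mathbb{R}$, $u_\pi:=u\circ(I^\pi)^{-1}:\mathbb{W}^{|\pi|}\to\mathbb{R}$. $\mathcal{D}_\theta$ (for the characteristic measure $\frac\theta2\mathbf 1_{[0,1]}dx$) is the set of $f\in C^2_0(\overline{\mathbb{W}^n})$ such that for all $1\le a<b\le n$ and all $x\in\overline{\mathbb{W}^n}$ with $x_a=x_b$, writing $m=b-a+1$, $$\frac12\sum_{\substack{a\le i,j\le b\\ i\ne j}}\frac{\partial^2f}{\partial x_i\partial x_j}(x)=-\frac\theta2\sum_{i=a}^b\frac{\partial f}{\partial x_i}(x)\sum_{k=1}^{m-1}\frac{m}{k(m-k)}\,\mathrm{sign}(k-i+a-1),\qquad \mathrm{sign}(0)=1 .$$ *)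

(* Defs.v *)
From HB Require Import structures.
From mathcomp Require Import all_boot all_order all_algebra.
From mathcomp Require Import all_classical all_reals all_analysis measurable_realfun.

Set Implicit Arguments.
Unset Strict Implicit.
Unset Printing Implicit Defensive.
Import Order.TTheory GRing.Theory Num.Theory.
Import numFieldNormedType.Exports.
Local Open Scope classical_set_scope.
Local Open Scope ring_scope.

Section borel_matrix.
Context (R : realType) (m n : nat).

HB.instance Definition _ :=
  @isMeasurable.Build (sigma_display (@open 'M[R]_(m, n))) 'M[R]_(m, n)
    <<s @open 'M[R]_(m, n) >>
    (@sigma_algebra0 _ setT _) (@sigma_algebraC 'M[R]_(m, n) _)
    (@sigma_algebra_bigcup _ setT _).

End borel_matrix.


Section measurable_rV.
Context (R : realType).

Lemma open_measurable_mx m n (U : set 'M[R]_(m, n)) : open U -> measurable U.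
Proof. exact: sub_sigma_algebra. Qed.

Definition rat_box n (q : 'rV[rat]_n * 'rV[rat]_n) : set 'rV[R]_n :=
  [set v | forall i, v 0 i \in `]ratr (q.1 0 i), ratr (q.2 0 i)[ ].

Lemma open_bigcup_rat_box n (U : set 'rV[R]_n) : open U ->
  U = \bigcup_(q in [set q | rat_box q `<=` U]) rat_box q.
Proof.
move=> oU; apply/seteqP; split; last by move=> v [q] qU /qU.
move=> v Uv.
have /nbhs_ballP[e /= e0 eU] : nbhs v U by exact: open_nbhs_nbhs.
have lo i : {q : rat | ratr q \in `](v 0 i - e), (v 0 i)[}.
  by apply: cid; apply: rat_in_itvoo; rewrite ltrBlDr ltrDl.
have hi i : {q : rat | ratr q \in `](v 0 i), (v 0 i + e)[}.
  by apply: cid; apply: rat_in_itvoo; rewrite ltrDl.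
exists (\row_i sval (lo i), \row_i sval (hi i)) => /=.
  move=> w /= hw; apply: eU; split => // i j; rewrite !ord1.
  have := hw j; rewrite !mxE !in_itv /= => /andP[].
  case: (lo j) => l /=; case: (hi j) => h /=; rewrite !in_itv /=.
  move=> /andP[h1 h2] /andP[h3 h4] h5 h6.
  rewrite /ball /= ltr_distlC; apply/andP; split.
    exact: lt_trans h5.
  exact: lt_trans h6 _.
move=> i; rewrite !mxE in_itv /=.
case: (lo i) => l /=; case: (hi i) => h /=; rewrite !in_itv /=.
by move=> /andP[-> _] /andP[_ ->].
Qed.

Lemma measurable_fun_rV d (T : measurableType d) n (f : T -> 'rV[R]_n) :
  (forall i, measurable_fun [set: T] (fun t => f t 0 i)) ->
  measurable_fun [set: T] f.
Proof.
move=> mf; apply: (@measurability _ _ _ _ setT f (@open 'rV[R]_n)) => //.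
move=> _ [U oU <-]; rewrite setTI (open_bigcup_rat_box oU).
rewrite preimage_bigcup bigcup_mkcond; apply: countable_bigcupT_measurable => //.
move=> q; case: ifPn => // _.
rewrite [X in measurable X](_ : _ = \bigcap_(i in [set: 'I_n])
  ((fun t => f t 0 i) @^-1` `]ratr (q.1 0 i), ratr (q.2 0 i)[%classic)).
  apply: fin_bigcap_measurable => // i _.
  by rewrite -[X in measurable X]setTI; apply: mf => //; exact: measurable_itv.
by apply/seteqP; split=> t /= H i; [move=> _|]; exact: H.
Qed.

Lemma measurable_coord_rV n (i : 'I_n) :
  measurable_fun [set: 'rV[R]_n] (fun v => v 0 i).
Proof.
apply: (@measurability _ _ _ R setT _ (@RGenOpens.G R)).
  exact: RGenOpens.measurableE.
move=> _ [_ [a [b ->]] <-]; rewrite setTI; apply: open_measurable_mx; apply: open_comp.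
  by move=> v _; exact: coord_continuous.
exact: interval_open.
Qed.

Definition rV_cons n (p : measurableTypeR R * 'rV[R]_n) : 'rV[R]_n.+1 :=
  \row_i oapp (p.2 0) p.1 (unlift ord0 i).

Definition rV_uncons n (w : 'rV[R]_n.+1) : measurableTypeR R * 'rV[R]_n :=
  (w 0 0, \row_i w 0 (lift ord0 i)).

Lemma rV_consK n : cancel (@rV_cons n) (@rV_uncons n).
Proof.
move=> [x v]; rewrite /rV_uncons mxE unlift_none /=; congr pair.
by apply/rowP => i; rewrite !mxE liftK.
Qed.

Lemma measurable_rV_cons n : measurable_fun setT (@rV_cons n).
Proof.
apply: measurable_fun_rV => i; under eq_fun do rewrite mxE.
case: unliftP => [j|] _ /=; last exact: measurable_fst.
exact: measurableT_comp (measurable_coord_rV j) measurable_snd.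
Qed.

Lemma measurable_rV_uncons n : measurable_fun setT (@rV_uncons n).
Proof.
apply: measurable_fun_pair; first exact: measurable_coord_rV.
by apply: measurable_fun_rV => i; under eq_fun do rewrite mxE;
  exact: measurable_coord_rV.
Qed.

End measurable_rV.

Fixpoint lebesgue_rV (R : realType) (n : nat) : set 'rV[R]_n -> \bar R :=
  match n with
  | 0 => dirac (0 : 'rV[R]_0)
  | k.+1 => pushforward (@lebesgue_measure R \x @lebesgue_rV R k)%E
              (@rV_cons R k)
  end.
Arguments lebesgue_rV : clear implicits.

Section lebesgue_rV_measure.
Context (R : realType).
Local Open Scope ereal_scope.

Let sigma_finite_measure_pack d (T : measurableType d) (m : set T -> \bar R) :
  m set0 = 0 -> (forall A, 0 <= m A) -> semi_sigma_additive m ->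
  sigma_finite setT m ->
  exists mu : {sigma_finite_measure set T -> \bar R}, m = mu.
Proof.
move=> m0 mge0 msa msf.
pose M1 := isMeasure.Build _ _ _ m m0 mge0 msa.
pose M : {measure set T -> \bar R} := HB.pack m M1.
pose M2 := Measure_isSigmaFinite.Build _ _ _ M msf.
pose M' : {sigma_finite_measure set T -> \bar R} := HB.pack m M1 M2.
by exists M'.
Qed.

Let lebesgue_rV_ex n : exists mu : {sigma_finite_measure set 'rV[R]_n -> \bar R},
  lebesgue_rV R n = mu.
Proof.
elim: n => [|n [mu IH]] /=.
  by exists [the {sigma_finite_measure set _ -> \bar R} of dirac (0 : 'rV[R]_0)%R].
rewrite IH.
pose nu : {measure set (measurableTypeR R * 'rV[R]_n)%type -> \bar R} :=
  (@lebesgue_measure R \x mu)%E.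
have [F FT Ffin] : sigma_finite setT nu.
  have /sigma_finiteP[F [TF ndF Foo]] := sigma_finiteT (@lebesgue_measure R).
  have /sigma_finiteP[G [TG ndG Goo]] := sigma_finiteT mu.
  exists (fun n => F n `*` G n).
    rewrite -setXTT TF TG predeqE => -[x y]; split.
      move=> [/= [i _ Fix] [k _ Gky]]; exists (maxn i k) => //; split.
      - by move: x Fix; exact/subsetPset/ndF/leq_maxl.
      - by move: y Gky; exact/subsetPset/ndG/leq_maxr.
    by move=> [i _ []/= ? ?]; split; exists i.
  move=> k; have [? ?] := Foo k; have [? ?] := Goo k.
  split; first exact: measurableX.
  by rewrite /nu /= product_measure1E// lte_mul_pinfty// ge0_fin_numE.
pose m := @pushforward _ _ _ _ _ nu (@rV_cons R n).
have mcons := @measurable_rV_cons R n.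
have m0 : m set0 = 0%E by rewrite /m /pushforward preimage_set0 measure0.
have mge0 A : (0 <= m A)%E by exact: measure_ge0.
have msa : semi_sigma_additive m.
  move=> E mE tE mUE; rewrite /m /pushforward preimage_bigcup.
  apply: measure_semi_sigma_additive.
  - by move=> i; rewrite -[X in measurable X]setTI; exact: mcons.
  - apply/trivIsetP => /= i j _ _ ij; rewrite -preimage_setI.
    by move/trivIsetP : tE => /(_ _ _ _ _ ij) ->//; rewrite preimage_set0.
  - by rewrite -preimage_bigcup -[X in measurable X]setTI; exact: mcons.
have msf : sigma_finite setT m.
  exists (fun i => @rV_uncons R n @^-1` F i).
    by rewrite -preimage_bigcup -FT.
  move=> i; have [mF Fi] := Ffin i; split.
    by rewrite -[X in measurable X]setTI; exact: measurable_rV_uncons.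
  suff -> : m (@rV_uncons R n @^-1` F i) = nu (F i) by [].
  congr (nu _); apply/seteqP; split => x; rewrite /preimage /= rV_consK; exact.
exact: sigma_finite_measure_pack.
Qed.

Let lebesgue_rV0 n : lebesgue_rV R n set0 = 0.
Proof. by have [mu ->] := lebesgue_rV_ex n; exact: measure0. Qed.

Let lebesgue_rV_ge0 n A : 0 <= lebesgue_rV R n A.
Proof. by have [mu ->] := lebesgue_rV_ex n; exact: measure_ge0. Qed.

Let lebesgue_rV_sigma_additive n : semi_sigma_additive (lebesgue_rV R n).
Proof.
by have [mu ->] := lebesgue_rV_ex n; exact: measure_semi_sigma_additive.
Qed.

Let lebesgue_rV_sigma_finite n : sigma_finite setT (lebesgue_rV R n).
Proof. by have [mu ->] := lebesgue_rV_ex n; exact: sigma_finiteT. Qed.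

HB.instance Definition _ n := isMeasure.Build _ _ _ (lebesgue_rV R n)
  (@lebesgue_rV0 n) (@lebesgue_rV_ge0 n) (@lebesgue_rV_sigma_additive n).

HB.instance Definition _ n := Measure_isSigmaFinite.Build _ _ _
  (lebesgue_rV R n) (@lebesgue_rV_sigma_finite n).

End lebesgue_rV_measure.

Definition weyl (R : realType) (n : nat) : set 'rV[R]_n :=
  [set x | forall i j : 'I_n, (i < j)%N -> x 0 j < x 0 i].
Arguments weyl : clear implicits.

Definition closed_weyl (R : realType) (n : nat) : set 'rV[R]_n :=
  [set x | forall i j : 'I_n, (i < j)%N -> x 0 j <= x 0 i].
Arguments closed_weyl : clear implicits.

Lemma measurable_weyl (R : realType) n : measurable (weyl R n).
Proof.
rewrite (_ : weyl R n = \bigcap_(ij in [set ij : 'I_n * 'I_n | (ij.1 < ij.2)%N])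
  ((fun x : 'rV[R]_n => x 0 ij.1 - x 0 ij.2) @^-1` `]0, +oo[%classic)).
  apply: fin_bigcap_measurable => // ij _; rewrite -[X in measurable X]setTI.
  apply: measurable_funB => //; exact: measurable_coord_rV.
apply/seteqP; split=> x /= xP.
  by move=> [i j] /= ij; rewrite in_itv /= andbT subr_gt0; exact: xP.
move=> i j ij; have := xP (i, j) ij.
by rewrite /= in_itv /= andbT subr_gt0.
Qed.

Arguments measurable_weyl : clear implicits.

(* An ordered partition has at most n blocks, so it is a bounded sequence.
   Nonempty blocks in increasing order are automatically distinct. *)
Definition ordered_partitions (n : nat) : {set n.-bseq {set 'I_n}} :=
  [set p : n.-bseq {set 'I_n} |
    finset.partition [set B in p]%SET [set: 'I_n]%SET &&
    [forall j : 'I_(size p), forall l : 'I_(size p), (j < l)%N ==>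
      [forall a in nth finset.set0 p j, forall b in nth finset.set0 p l, (a < b)%N]]]%SET.

Section faces.
Context (R : realType) (n : nat).
Implicit Types p : seq {set 'I_n}.

Definition face p : set 'rV[R]_n :=
  [set x | closed_weyl R n x /\
    forall a b, x 0 a = x 0 b <-> exists2 B, B \in p & (a \in B) && (b \in B)].

Definition face_coords p (x : 'rV[R]_n) : 'rV[R]_(size p) :=
  \row_j oapp (x 0) 0 [pick i in nth finset.set0 p j].

(* The inverse of face_coords: the sum has a single term, the index j of the
   block that contains i. *)
Definition face_embed p (y : 'rV[R]_(size p)) : 'rV[R]_n :=
  \row_i \sum_(j < size p | i \in nth finset.set0 p j) y 0 j.

Lemma measurable_face_embed p : measurable_fun setT (@face_embed p).
Proof.
apply: measurable_fun_rV => i.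
rewrite (_ : (fun y => _) = fun y : 'rV[R]_(size p) =>
    \sum_(j < size p) if i \in nth finset.set0 p j then y 0 j else 0); last first.
  by apply/funext => y; rewrite mxE big_mkcond.
apply: measurable_sum => j; case: (i \in _); last exact: measurable_cst.
exact: measurable_coord_rV.
Qed.

Section bijection.
Variable p : n.-bseq {set 'I_n}.
Hypothesis p_op : p \in ordered_partitions n.

Let block i : exists j : 'I_(size p), i \in nth finset.set0 p j.
Proof.
move: p_op; rewrite inE => /andP[/and3P[/eqP pT _ _] _].
have : i \in finset.cover [set B in p]%SET by rewrite pT inE.
case/bigcupP => B; rewrite inE => Bp iB.
have Bs : (index B p < size p)%N by rewrite index_mem.
by exists (Ordinal Bs); rewrite nth_index.
Qed.

Let block_lt (j l : 'I_(size p)) a b : (j < l)%N ->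
  a \in nth finset.set0 p j -> b \in nth finset.set0 p l -> (a < b)%N.
Proof.
move: p_op; rewrite inE => /andP[_ /forallP/(_ j)/forallP/(_ l)/implyP H].
by move=> /H /forall_inP/[apply]/forall_inP/[apply].
Qed.

Let block_uniq (j l : 'I_(size p)) a :
  a \in nth finset.set0 p j -> a \in nth finset.set0 p l -> j = l.
Proof.
move=> aj al; apply: val_inj => /=; case: (ltngtP j l) => // jl.
  by have := block_lt jl aj al; rewrite ltnn.
by have := block_lt jl al aj; rewrite ltnn.
Qed.

Let block_rep (j : 'I_(size p)) : exists i, i \in nth finset.set0 p j.
Proof.
move: p_op; rewrite inE => /andP[/and3P[_ _ p0] _]; apply/set0Pn.
by apply: contraNneq p0 => <-; rewrite inE mem_nth.
Qed.

Let face_embedE (y : 'rV[R]_(size p)) i (j : 'I_(size p)) :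
  i \in nth finset.set0 p j -> face_embed y 0 i = y 0 j.
Proof.
move=> ij; rewrite mxE (big_pred1 j) // => l /=.
by apply/idP/eqP => [il|->//]; exact: block_uniq il ij.
Qed.

Let face_coordsE x i (j : 'I_(size p)) : face p x ->
  i \in nth finset.set0 p j -> face_coords p x 0 j = x 0 i.
Proof.
move=> [_ xp] ij; rewrite mxE; case: pickP => [k kj|/(_ i)]; last by rewrite ij.
by apply/xp; exists (nth finset.set0 p j); [exact: mem_nth|rewrite kj ij].
Qed.

Lemma face_coords_weyl x : face p x -> weyl R (size p) (face_coords p x).
Proof.
move=> xp j l jl; have [a aj] := block_rep j; have [b bl] := block_rep l.
rewrite (face_coordsE xp aj) (face_coordsE xp bl).
have ab := block_lt jl aj bl; case: xp => cx xp.
rewrite lt_neqAle cx// andbT; apply/eqP => /xp[B /(nthP finset.set0)[k kp <-]].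
case/andP => bk ak.
have jk := @block_uniq j (Ordinal kp) a aj ak.
have lk := @block_uniq l (Ordinal kp) b bl bk.
by move: jl; rewrite jk lk ltnn.
Qed.

Lemma face_embed_face y : weyl R (size p) y -> face p (face_embed y).
Proof.
move=> yw; split=> [a b ab|a b].
  have [j aj] := block a; have [l bl] := block b.
  rewrite (face_embedE _ aj) (face_embedE _ bl).
  case: (ltngtP j l) => [jl|lj|/val_inj->//]; first exact/ltW/yw.
  by have := ltn_trans ab (block_lt lj bl aj); rewrite ltnn.
have [j aj] := block a; have [l bl] := block b.
rewrite (face_embedE _ aj) (face_embedE _ bl); split=> [yjl|].
  exists (nth finset.set0 p j); first exact: mem_nth.
  rewrite aj /=; suff -> : j = l by [].
  apply: val_inj => /=; case: (ltngtP j l) => // jl;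
    by have := yw _ _ jl; rewrite yjl ltxx.
move=> [B /(nthP finset.set0)[k kp <-]] /andP[ak bk].
rewrite (@block_uniq j (Ordinal kp) a aj ak).
by rewrite (@block_uniq l (Ordinal kp) b bl bk).
Qed.

Lemma face_coordsK x : face p x -> face_embed (face_coords p x) = x.
Proof.
move=> xp; apply/rowP => i; have [j ij] := block i.
by rewrite (face_embedE _ ij) (face_coordsE xp ij).
Qed.

Lemma face_embedK y :
  weyl R (size p) y -> face_coords p (face_embed y) = y.
Proof.
move=> yw; apply/rowP => j; have [i ij] := block_rep j.
by rewrite (face_coordsE (face_embed_face yw) ij) (face_embedE _ ij).
Qed.

End bijection.

Definition face_measure p : set 'rV[R]_n -> \bar R :=
  pushforward (mrestr (lebesgue_rV R (size p)) (measurable_weyl R (size p)))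
    (@face_embed p).

Let face_measure_ex p :
  exists mu : {measure set 'rV[R]_n -> \bar R}, face_measure p = mu.
Proof.
pose nu := mrestr (lebesgue_rV R (size p)) (measurable_weyl R (size p)).
unshelve eexists (pushforward nu (@face_embed p)).
exact: measurable_face_embed.
by [].
Qed.

Let face_measure0 p : face_measure p classical_sets.set0 = 0%E.
Proof. by have [mu ->] := face_measure_ex p; exact: measure0. Qed.

Let face_measure_ge0 p A : (0 <= face_measure p A)%E.
Proof. by have [mu ->] := face_measure_ex p; exact: measure_ge0. Qed.

Let face_measure_sigma_additive p : semi_sigma_additive (face_measure p).
Proof.
by have [mu ->] := face_measure_ex p; exact: measure_semi_sigma_additive.
Qed.

HB.instance Definition _ p := isMeasure.Build _ _ _ (face_measure p)
  (@face_measure0 p) (@face_measure_ge0 p) (@face_measure_sigma_additive p).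

End faces.

Section calculus.
Context (R : realType) (n : nat).
Implicit Types (f : 'rV[R]_n -> R) (U : set 'rV[R]_n) (x y : 'rV[R]_n).

Definition dot x y : R := \sum_i x 0 i * y 0 i.

(* The library norm on 'rV[R]_n is the sup norm. *)
Definition enorm x : R := Num.sqrt (dot x x).

Definition partial (i : 'I_n) f : 'rV[R]_n -> R := 'D_(delta_mx 0 i) f.

Definition grad f x : 'rV[R]_n := \row_i partial i f x.

Definition laplacian f x : R := \sum_i partial i (partial i f) x.

Fixpoint C_on (k : nat) U f : Prop :=
  (forall x, U x -> {for x, continuous f}) /\
  match k with
  | 0 => True
  | k'.+1 => forall i, (forall x, U x -> derivable f x (delta_mx 0 i)) /\
                       C_on k' U (partial i f)
  end.

(* A function on the closed Weyl chamber of class C^k is represented by one of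
   its extensions, a total function that is C^k on an open neighbourhood of the
   chamber; its partial derivatives on the chamber do not depend on that choice,
   the chamber being the closure of its interior. *)
Definition C_closed_weyl (k : nat) f : Prop :=
  exists U, [/\ open U, closed_weyl R n `<=` U & C_on k U f].

Definition vanishes_at_infinity f : Prop :=
  forall e, 0 < e -> exists M, forall x,
    closed_weyl R n x -> M < enorm x -> `|f x| < e.

Definition C2_0 f : Prop :=
  [/\ C_closed_weyl 2 f, vanishes_at_infinity f,
      forall i, vanishes_at_infinity (partial i f) &
      forall i j, vanishes_at_infinity (partial i (partial j f))].

Definition C1_b f : Prop :=
  C_closed_weyl 1 f /\
  exists M, forall x, closed_weyl R n x ->
    `|f x| <= M /\ forall i, `|partial i f x| <= M.

End calculus.

Section sticky.
Context (R : realType) (n : nat) (theta : R).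

(* The convention is sign 0 = 1. *)
Definition signp (z : int) : R := if 0 <= z then 1 else -1.

(* Indices start at 0 here; only differences of indices occur. *)
Definition D_theta (f : 'rV[R]_n -> R) : Prop :=
  C2_0 f /\
  forall (a b : 'I_n) (x : 'rV[R]_n),
    (a < b)%N -> closed_weyl R n x -> x 0 a = x 0 b ->
    let m := (b - a + 1)%N in
    2^-1 * \sum_(i < n | (a <= i <= b)%N)
             \sum_(j < n | (a <= j <= b)%N && (i != j))
               partial i (partial j f) x =
    - (theta / 2) * \sum_(i < n | (a <= i <= b)%N)
        partial i f x *
        \sum_(1 <= k < m)
          m%:R / (k%:R * (m - k)%:R) * signp (k%:Z - i%:Z + a%:Z - 1).

Definition weight (p : seq {set 'I_n}) : R :=
  theta ^ ((size p)%:Z - n%:Z) * \prod_(B <- p) (#|B|%:R)^-1.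

Definition m_theta (A : set 'rV[R]_n) : \bar R :=
  (\sum_(p in ordered_partitions n) (weight p)%:E * face_measure p A)%E.

Lemma weight_ge0 p : 0 < theta -> 0 <= weight p.
Proof.
move=> theta0; apply: mulr_ge0; first exact/exprz_ge0/ltW.
by apply: prodr_ge0 => B _; rewrite invr_ge0.
Qed.

Lemma m_theta_measure : 0 < theta ->
  exists mu : {measure set 'rV[R]_n -> \bar R}, m_theta = mu.
Proof.
move=> theta0.
have partial_sum (s : seq (n.-bseq {set 'I_n})) :
    exists mu : {measure set 'rV[R]_n -> \bar R},
    (fun A => \sum_(p <- s) (weight p)%:E * face_measure p A)%E = mu.
  elim: s => [|p s [mu IH]].
    by exists mzero; apply/funext => A; rewrite big_nil.
  exists (measure_add (mscale (NngNum (weight_ge0 p theta0)) (face_measure p)) mu).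
  by apply/funext => A; rewrite [RHS]measure_addE big_cons -IH.
have [mu muE] := partial_sum (enum (ordered_partitions n)).
by exists mu; rewrite -muE; apply/funext => A; rewrite /m_theta -big_enum.
Qed.

Definition on_face (p : seq {set 'I_n}) (u : 'rV[R]_n -> R) : 'rV[R]_(size p) -> R :=
  u \o @face_embed R n p.
Arguments on_face : clear implicits.

Definition theta_form (u v : 'rV[R]_n -> R) : \bar R :=
  (\sum_(p in ordered_partitions n) (weight p)%:E *
     \int[lebesgue_rV R (size p)]_(y in weyl R (size p))
       (dot (grad (on_face p u) y) (grad (on_face p v) y))%:E)%E.

End sticky.
Arguments m_theta {R} n theta.
Arguments on_face {R n} p u y.

(* Main.v *)
(* Decompose m_theta into the faces of the chamber. On the face of a partition the
   Laplacian of u is the Laplacian of the restriction of u minus the mixed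
   derivatives inside the blocks, and the boundary condition of D_theta expresses
   these as a sum, over all ways of splitting a block in two, of differences of
   the normal derivatives of u on the face that has the split block. Integrating
   the Laplacian of the restriction by parts produces fluxes through the walls
   y_j = y_(j+1), that is, the same differences on the faces obtained by merging
   two neighbouring blocks. The weight of a partition with a block of size m split
   into k and m - k is theta m / (k (m - k)) times the weight of the unsplit one,
   so for compactly supported v all boundary terms cancel. A general v is
   truncated by a cutoff chi(x / k); the error term contains v grad u . grad chi,
   which is O(exp(-c|x|) / k), and dominated convergence concludes. *)

Require Import Defs.
From mathcomp Require Import all_boot all_order all_algebra.
From mathcomp Require Import all_classical all_reals all_analysis measurable_realfun.
From mathcomp Require Import ring lra zify.
Import Order.TTheory GRing.Theory Num.Theory.
Import numFieldNormedType.Exports.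
Local Open Scope classical_set_scope.
Local Open Scope ring_scope.
Set Implicit Arguments.
Unset Strict Implicit.
Unset Printing Implicit Defensive.

(** * Lebesgue measure on row vectors *)

(** Among the terms with second derivatives, only the product of the whole Laplacian with [v] is
    assumed integrable, so the coordinates cannot be integrated by parts one at a time for a general
    [v]; this forces the detour through compactly supported test functions. The cancellation is a
    double count: a wall obtained by merging is a pair (S, s) with s in S, a split in the boundary
    condition is a pair (S, s) with s outside S. Ordered partitions are therefore encoded by sets of
    cuts, where splitting and merging add and remove an element and [s |: S] matches the two kinds
    of pairs. There are m possible cuts between n = m + 1 indices, hence the positive n. A face is
    pulled back to an open chamber by a map that only repeats coordinates. Since u and v extend to a
    neighbourhood of the closed chamber, the pullbacks can be differentiated on the walls as well,
    and the flux comes from the fundamental theorem of calculus on coordinate lines. Wall points are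
    parametrised by the chamber of one dimension less, exactly as [face_measure] normalises faces,
    so no factor from a surface measure appears. *)

Section insertion.
Context {R : realType}.

Definition insert N (i : 'I_N.+1) (x : R) (z : 'rV[R]_N) : 'rV[R]_N.+1 :=
  \row_k oapp (z 0) x (unlift i k).

Lemma insert_same N (i : 'I_N.+1) x (z : 'rV[R]_N) : insert i x z 0 i = x.
Proof. by rewrite mxE unlift_none. Qed.

Lemma insert_lift N (i : 'I_N.+1) x (z : 'rV[R]_N) j :
  insert i x z 0 (lift i j) = z 0 j.
Proof. by rewrite mxE liftK. Qed.

Lemma rV_consE N x (z : 'rV[R]_N) : rV_cons (x, z) = insert ord0 x z.
Proof. by []. Qed.

Lemma rV_cons_insert N (i : 'I_N.+1) x0 x (z : 'rV[R]_N) :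
  rV_cons (x0, insert i x z) = insert (lift ord0 i) x (rV_cons (x0, z)).
Proof.
rewrite !rV_consE; apply/rowP => k.
case: (unliftP ord0 k) => [k' ->|->]; last first.
  have E : lift (lift ord0 i) ord0 = ord0 :> 'I_N.+2 by apply: val_inj.
  by rewrite insert_same -[X in _ = fun_of_matrix _ _ X]E insert_lift insert_same.
rewrite insert_lift; case: (unliftP i k') => [j ->|->]; last by rewrite !insert_same.
have -> : lift ord0 (lift i j) = lift (lift ord0 i) (lift ord0 j).
  by apply: val_inj; rewrite /= /bump; lia.
by rewrite !insert_lift.
Qed.

Lemma measurable_insert N (i : 'I_N.+1) : measurable_fun setT
  (fun p : measurableTypeR R * 'rV[R]_N => insert i p.1 p.2).
Proof.
apply: measurable_fun_rV => k; under eq_fun do rewrite mxE.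
case: unliftP => [j|] _ /=; last exact: measurable_fst.
exact: measurableT_comp (measurable_coord_rV j) measurable_snd.
Qed.

Local Open Scope ereal_scope.

Lemma ge0_integral_rV_cons N (f : 'rV[R]_N.+1 -> \bar R) :
  measurable_fun setT f -> (forall y, 0 <= f y) ->
  \int[lebesgue_rV R N.+1]_y f y =
  \int[(@lebesgue_measure R \x lebesgue_rV R N)%E]_p f (rV_cons p).
Proof.
move=> mf f0.
rewrite [LHS](@ge0_integral_pushforward _ _ _ _ R (@rV_cons R N)
  (@measurable_rV_cons R N) (@lebesgue_measure R \x lebesgue_rV R N)) //.
Qed.

(** [lebesgue_rV] is built by prepending coordinates, whereas integration by parts needs any
    coordinate i innermost. The induction applies Tonelli to coordinate 0 on both sides, and
    [rV_cons_insert] lets the insertion at i pass under it. *)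
Lemma ge0_integral_insert N (i : 'I_N.+1) (f : 'rV[R]_N.+1 -> \bar R) :
  measurable_fun setT f -> (forall y, 0 <= f y) ->
  \int[lebesgue_rV R N.+1]_y f y =
  \int[lebesgue_rV R N]_z \int[lebesgue_measure]_x f (insert i x z).
Proof.
elim: N i f => [|N IH] i f mf f0.
  rewrite ge0_integral_rV_cons// fubini_tonelli2//; last first.
    exact: measurableT_comp (@measurable_rV_cons R _).
  by rewrite (ord1 i).
rewrite ge0_integral_rV_cons//.
have mfc := measurableT_comp mf (@measurable_rV_cons R _).
case: (unliftP ord0 i) => [{}i ->|->]; last by rewrite fubini_tonelli2.
pose h w := \int[lebesgue_measure]_x f (insert (lift ord0 i) x w).
have mfi := measurableT_comp mf (measurable_insert (lift ord0 i)).
have mh : measurable_fun setT h.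
  exact: (@measurable_fun_fubini_tonelli_G _ _ _ _ R (@lebesgue_measure R) _ mfi (fun=> f0 _)).
have h0 w : 0 <= h w by apply: integral_ge0.
have mhc := measurableT_comp mh (@measurable_rV_cons R _).
rewrite [RHS](ge0_integral_rV_cons mh h0).
rewrite [RHS](fubini_tonelli1 _ mhc); last by move=> x; exact: h0.
rewrite [LHS](fubini_tonelli1 _ mfc); last by move=> x; exact: f0.
apply: eq_integral => x0 _; rewrite /fubini_F.
have mx0 : measurable_fun setT (fun w : 'rV[R]_N.+1 => f (rV_cons (x0, w))).
  exact: (measurableT_comp mfc (@pair1_measurable _ _ _ _ x0)).
rewrite (IH i _ mx0)//.
apply: eq_integral => z _; apply: eq_integral => x _.
by rewrite rV_cons_insert.
Qed.

(** The nonnegative formula applied to an indicator. As an equality of measures it also serves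
    functions that change sign, through a change of variables and Fubini. *)
Lemma lebesgue_rV_insert N (i : 'I_N.+1) (A : set 'rV[R]_N.+1) : measurable A ->
  lebesgue_rV R N.+1 A =
  pushforward (@lebesgue_measure R \x lebesgue_rV R N)%E
    (fun p => insert i p.1 p.2) A.
Proof.
move=> mA; have mi := @measurable_insert N i.
pose g y : \bar R := (\1_A y)%:E.
have mg : measurable_fun setT g by apply/measurable_EFinP; exact: measurable_indic.
have g0 y : 0 <= g y by rewrite lee_fin.
rewrite -[LHS]/(lebesgue_rV R N.+1 A).
have mB : measurable ((fun p : measurableTypeR R * 'rV[R]_N => insert i p.1 p.2) @^-1` A).
  by rewrite -[X in measurable X]setTI; exact: mi.
transitivity (\int[lebesgue_rV R N.+1]_y g y); first by rewrite integral_indic// setIT.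
rewrite (ge0_integral_insert i mg)//.
have mgi := measurableT_comp mg mi.
rewrite -[LHS](@fubini_tonelli2 _ _ _ _ R (@lebesgue_measure R) (lebesgue_rV R N) _ mgi (fun=> g0 _)).
rewrite -[RHS]/((@lebesgue_measure R \x lebesgue_rV R N)%E (_ @^-1` A)).
by rewrite -[in RHS](setIT (_ @^-1` _)) -integral_indic.
Qed.

Section integrable_insert.
Variables (N : nat) (i : 'I_N.+1) (f : 'rV[R]_N.+1 -> \bar R).
Hypothesis intf : (lebesgue_rV R N.+1).-integrable setT f.

Let fi (p : measurableTypeR R * 'rV[R]_N) := f (insert i p.1 p.2).

Let mf : measurable_fun setT f. Proof. by case/integrableP : intf. Qed.

Let intfi : (@lebesgue_measure R \x lebesgue_rV R N)%E.-integrable setT fi.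
Proof.
case/integrableP : intf => _ foo; apply/integrableP; split.
  exact: measurableT_comp mf (measurable_insert i).
have maf : measurable_fun setT (fun y => `|f y|) by exact: measurableT_comp.
rewrite (fubini_tonelli2 (fun p => `|fi p|))//; last first.
  exact: measurableT_comp maf (measurable_insert i).
by rewrite -(ge0_integral_insert i maf).
Qed.

Lemma integral_insert : \int[lebesgue_rV R N.+1]_y f y =
  \int[lebesgue_rV R N]_z \int[lebesgue_measure]_x f (insert i x z).
Proof.
have mi := @measurable_insert N i.
transitivity (\int[pushforward (@lebesgue_measure R \x lebesgue_rV R N)%E
    (fun p => insert i p.1 p.2)]_y f y).
  by apply: eq_measure_integral => A mA _; exact: lebesgue_rV_insert.
rewrite integral_pushforward// preimage_setT.
by rewrite -(@integral21_prod_meas1 _ _ _ _ R (@lebesgue_measure R) (lebesgue_rV R N) _ intfi).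
Qed.

End integrable_insert.

End insertion.

(** * Integrability from exponential decay *)

Section integrability.
Context {R : realType}.

Lemma open_weyl n : open (weyl R n).
Proof.
rewrite (_ : weyl R n = \big[setI/setT]_(ij : 'I_n * 'I_n | (ij.1 < ij.2)%N)
   ((fun x : 'rV[R]_n => x 0 ij.1 - x 0 ij.2) @^-1` [set t | 0 < t])); last first.
  apply/seteqP; split=> x /=.
    move=> xW; elim/big_ind : _ => //= -[i j] /= ij.
    by rewrite subr_gt0; exact: xW.
  move=> + i j ij; rewrite (bigD1 (i, j))//= => -[] /=.
  by rewrite subr_gt0.
elim/big_ind : _ => [||ij _]; [exact: openT|exact: openI|].
apply: open_comp; last exact: open_gt.
by move=> x _; apply: continuousB; exact: coord_continuous.
Qed.

Lemma weyl_sub n : weyl R n `<=` closed_weyl R n.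
Proof. by move=> x xW i j ij; exact/ltW/xW. Qed.

Lemma measurable_fun_open n (W : set 'rV[R]_n) (f : 'rV[R]_n -> R) :
  open W -> (forall x, W x -> {for x, continuous f}) -> measurable_fun W f.
Proof.
move=> oW cf; apply: (@measurability _ _ _ R W f (@RGenOpens.G R)).
  exact: RGenOpens.measurableE.
move=> _ [_ [a [b ->]] <-]; suff : open (W `&` f @^-1` `]a, b[%classic) by exact: open_measurable_mx.
rewrite openE => x [Wx fx]; apply: filterI; first exact: open_nbhs_nbhs.
by apply: (cf x Wx); apply: open_nbhs_nbhs; split => //; exact: interval_open.
Qed.

Lemma enorm_ge0 n (x : 'rV[R]_n) : 0 <= enorm x.
Proof. exact: sqrtr_ge0. Qed.

Lemma dot_ge0 n (x : 'rV[R]_n) : 0 <= dot x x.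
Proof. by apply: sumr_ge0 => i _; rewrite -expr2 sqr_ge0. Qed.

Lemma coord_le_enorm n (x : 'rV[R]_n) i : `|x 0 i| <= enorm x.
Proof.
rewrite -sqrtr_sqr ler_sqrt ?dot_ge0// /dot (bigD1 i)//= -expr2 lerDl.
by apply: sumr_ge0 => j _; rewrite -expr2 sqr_ge0.
Qed.

Lemma sum_abs_le_enorm n (x : 'rV[R]_n) : \sum_i `|x 0 i| <= n%:R * enorm x.
Proof.
rewrite mulr_natl -[X in _ *+ X]card_ord -sumr_const.
by apply: ler_sum => i _; exact: coord_le_enorm.
Qed.

Local Open Scope ereal_scope.

Lemma integral_exp_abs_lty (c : R) : (0 < c)%R ->
  \int[lebesgue_measure]_x (expR (- c * `|x|))%:E < +oo.
Proof.
move=> c0; rewrite ge0_symfun_integralT; last 3 first.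
- by move=> x; exact: expR_ge0.
- move=> x; apply: continuous_comp; last exact: continuous_expR.
  by apply: continuousM; [exact: cst_continuous|exact: norm_continuous].
- by move=> x /=; rewrite normrN.
apply: lte_mul_pinfty => //; rewrite -set_itvcy.
(* On the half-line the integrand is 1 / c times the exponential density. *)
rewrite (eq_integral (fun x : measurableTypeR R => (c^-1)%:E * (exponential_pdf c x)%:E)); last first.
  move=> x; rewrite inE/= in_itv/= andbT => x0.
  by rewrite exponential_pdfE// ger0_norm// -EFinM mulrA mulVf ?gt_eqF// mul1r.
apply: (@integrable_lty _ _ _ lebesgue_measure `[0%R, +oo[%classic) => //.
apply: integrableZl => //; apply: (integrableS measurableT) => //.
exact: integrable_exponential_pdf.
Qed.

Lemma measurable_exp_sum n (c : R) :
  measurable_fun setT (fun y : 'rV[R]_n => expR (- c * \sum_i `|y 0%R i|)).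
Proof.
apply: measurableT_comp => //; apply: measurable_funM => //.
apply: measurable_sum => i; apply: measurableT_comp => //.
exact: measurable_coord_rV.
Qed.

Lemma integral_exp_sum_lty n (c : R) : (0 < c)%R ->
  \int[lebesgue_rV R n]_y (expR (- c * \sum_i `|y 0%R i|))%:E < +oo.
Proof.
move=> c0; elim: n => [|n IH].
  have mf := @measurable_exp_sum 0 c.
  by rewrite integral_dirac//= ?diracT ?mul1e ?ltry//; exact/measurable_EFinP.
rewrite (ge0_integral_insert ord0); last 2 first.
- by apply/measurable_EFinP; exact: measurable_exp_sum.
- by move=> y; rewrite lee_fin expR_ge0.
pose I := \int[lebesgue_measure]_x (expR (- c * `|x|))%:E.
rewrite (eq_integral (fun z : 'rV[R]_n => (expR (- c * \sum_i `|z 0%R i|))%:E * I)); last first.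
  move=> z _; rewrite -ge0_integralZl//; last first.
    apply/measurable_EFinP; apply: measurableT_comp => //.
    by apply: measurable_funM => //; exact: measurableT_comp.
  apply: eq_integral => x _; rewrite big_ord_recl insert_same mulrDr expRD EFinM muleC.
  by congr ((expR (_ * _))%:E * _); apply: eq_bigr => j _; rewrite insert_lift.
have I0 : 0 <= I.
  by apply: integral_ge0 => x _; rewrite lee_fin expR_ge0.
rewrite ge0_integralZr//; last by apply/measurable_EFinP; exact: measurable_exp_sum.
have J0 : 0 <= \int[lebesgue_rV R n]_y (expR (- c * \sum_i `|y 0%R i|))%:E.
  by apply: integral_ge0 => x _; rewrite lee_fin expR_ge0.
by apply: lte_mul_pinfty => //; [rewrite ge0_fin_numE|exact: integral_exp_abs_lty].
Qed.

Lemma integrable_le_exp n (W : set 'rV[R]_n) (f : 'rV[R]_n -> R) (K c : R) :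
  (0 < c)%R -> measurable W -> measurable_fun W f ->
  (forall y, W y -> `|f y| <= K * expR (- c * enorm y))%R ->
  (lebesgue_rV R n).-integrable W (EFin \o f).
Proof.
(* The sum of the |y_i| is at most n times the Euclidean norm, so the rate c / (n + 1) gives a
   dominating function that factors over the coordinates; n + 1 instead of n covers dimension 0. *)
move=> c0 mW mf fK; pose c' := (c / n.+1%:R)%R.
have c'0 : (0 < c')%R by rewrite divr_gt0.
have intE : (lebesgue_rV R n).-integrable setT
    (fun y : 'rV[R]_n => (expR (- c' * \sum_i `|y 0%R i|))%:E).
  apply/integrableP; split; first by apply/measurable_EFinP; exact: measurable_exp_sum.
  under eq_integral do rewrite gee0_abs ?lee_fin ?expR_ge0//.
  exact: integral_exp_sum_lty.
apply: (le_integrable mW (g := fun y : 'rV[R]_n => `|K|%:E * (expR (- c' * \sum_i `|y 0%R i|))%:E)).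
- exact/measurable_EFinP.
- move=> y Wy /=; rewrite lee_fin (le_trans (fK _ Wy))//.
  rewrite [leRHS]ger0_norm ?mulr_ge0 ?expR_ge0//.
  apply: (@le_trans _ _ (`|K| * expR (- c * enorm y))%R).
    by rewrite ler_wpM2r ?expR_ge0// ler_norm.
  rewrite ler_wpM2l// ler_expR !mulNr lerN2 -mulrA ler_pM2l// mulrC ler_pdivrMr//.
  rewrite (le_trans (sum_abs_le_enorm y))// mulrC ler_wpM2l ?enorm_ge0//.
  by rewrite ler_nat.
- by apply: integrableZl => //; exact: (integrableS measurableT).
Qed.

End integrability.

(** * Integration by parts on the Weyl chamber *)

Section lines.
Context {R : realType}.

Lemma is_derive_line (V : normedModType R) (f : V -> R) (p v : V) (x l : R) :
  is_derive (p + x *: v) v f l -> is_derive x 1 (fun t : R => f (p + t *: v)) l.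
Proof.
move=> [df fl].
have E : (fun h : R => h^-1 *: ((f (p + (h *: 1 + x) *: v)) - f (p + x *: v)))
    = (fun h => h^-1 *: ((f \o shift (p + x *: v)) (h *: v) - f (p + x *: v))).
  apply/funext => h; rewrite /= /shift/=; congr (_ *: (f _ - _)).
  by rewrite [h *: 1]mulr1 scalerDl addrCA.
split; first by move: df; rewrite /derivable -E.
by move: fl; rewrite /derive -E.
Qed.

Lemma insertE N (i : 'I_N.+1) (x x0 : R) (z : 'rV[R]_N) :
  insert i x z = insert i x0 z + (x - x0) *: delta_mx 0 i.
Proof.
apply/rowP => k; rewrite mxE [RHS]mxE !mxE.
case: unliftP => [j|] ->; rewrite eqxx/=.
  by rewrite eq_sym (negbTE (neq_lift _ _)) mulr0 addr0.
by rewrite eqxx mulr1 addrC subrK.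
Qed.

End lines.

Section weyl_insert.
Context {R : realType}.
Variables (N : nat) (i : 'I_N.+1) (z : 'rV[R]_N).

(** In these lemmas [unlift ord_max i] is the index i read in ['I_N], absent when i is last, and
    [unlift ord0 i] is i - 1, absent when i is first. After insertion at i they name the lower and
    the upper neighbour of the new coordinate, and monotonicity of z reduces all other comparisons
    to these two. *)
Let below (b : 'I_N) : closed_weyl R N z -> (i <= b)%N ->
  exists2 j, unlift ord_max i = Some j & z 0 b <= z 0 j.
Proof.
move=> zW ib; have iN : (i < N)%N by exact: leq_ltn_trans ib (ltn_ord b).
have -> : i = lift ord_max (Ordinal iN) by apply: val_inj; rewrite /= /bump; lia.
exists (Ordinal iN); first exact: liftK.
case: (ltngtP i b) ib => // [ib _|ib _]; first exact: zW.
by rewrite (_ : Ordinal iN = b)//; exact: val_inj.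
Qed.

Let above (a : 'I_N) : closed_weyl R N z -> (a < i)%N ->
  exists2 j, unlift ord0 i = Some j & z 0 j <= z 0 a.
Proof.
move=> zW ai; have iN : (i.-1 < N)%N by have := ltn_ord i; lia.
have -> : i = lift ord0 (Ordinal iN) by apply: val_inj; rewrite /= /bump; lia.
exists (Ordinal iN); first exact: liftK.
case: (ltngtP a i.-1) => [ai'|ai'|ai']; [exact: zW|lia|].
by rewrite (_ : Ordinal iN = a)//; exact: val_inj.
Qed.

Lemma weyl_insertP x : weyl R N z -> weyl R N.+1 (insert i x z) <->
  (forall j, unlift ord_max i = Some j -> z 0 j < x) /\
  (forall j, unlift ord0 i = Some j -> x < z 0 j).
Proof.
move=> zW; split=> [yW|[lo hi] a b].
  split=> j; case: unliftP => // j' iE [jj]; rewrite -{j}jj.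
    have : (i < lift i j')%N by have := ltn_ord j'; rewrite iE /= /bump; lia.
    by move=> /yW; rewrite insert_lift insert_same.
  have : (lift i j' < i)%N by rewrite iE /= /bump; lia.
  by move=> /yW; rewrite insert_lift insert_same.
case: (unliftP i a) => [a'|] ->; case: (unliftP i b) => [b'|] ->;
  rewrite ?insert_lift ?insert_same.
- by move=> ab; apply: zW; move: ab; rewrite /= /bump; lia.
- move=> /= ab; have /(above (weyl_sub zW))[j /hi xj zj] : (a' < i)%N.
    by apply: leq_ltn_trans ab; exact: leq_addl.
  exact: lt_le_trans xj zj.
- move=> /= ab; have /(below (weyl_sub zW))[j /lo xj zj] : (i <= b')%N.
    by rewrite leqNgt; apply/negP => bi; move: ab; rewrite /bump (leqNgt i) bi add0n ltnNge ltnW.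
  exact: le_lt_trans zj xj.
- by rewrite ltnn.
Qed.

Lemma closed_weyl_insert x : closed_weyl R N z ->
  (forall j, unlift ord_max i = Some j -> z 0 j <= x) ->
  (forall j, unlift ord0 i = Some j -> x <= z 0 j) ->
  closed_weyl R N.+1 (insert i x z).
Proof.
move=> zW lo hi a b.
case: (unliftP i a) => [a'|] ->; case: (unliftP i b) => [b'|] ->;
  rewrite ?insert_lift ?insert_same.
- by move=> ab; apply: zW; move: ab; rewrite /= /bump; lia.
- move=> /= ab; have /(above zW)[j /hi xj zj] : (a' < i)%N.
    by apply: leq_ltn_trans ab; exact: leq_addl.
  exact: le_trans xj zj.
- move=> /= ab; have /(below zW)[j /lo xj zj] : (i <= b')%N.
    by rewrite leqNgt; apply/negP => bi; move: ab; rewrite /bump (leqNgt i) bi add0n ltnNge ltnW.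
  exact: le_trans zj xj.
- by rewrite ltnn.
Qed.

Lemma weyl_insert_inv x : weyl R N.+1 (insert i x z) -> weyl R N z.
Proof.
move=> yW a b ab; rewrite -!(insert_lift i x z); apply: yW.
by rewrite /= /bump; lia.
Qed.

End weyl_insert.

Section duplication.
Context {R : realType}.

Definition dup N (j : 'I_N) (z : 'rV[R]_N) : 'rV[R]_N.+1 :=
  insert (lift ord0 j) (z 0 j) z.

(** Lowering coordinate j onto its lower neighbour and raising coordinate j + 1 onto its upper
    neighbour lead to the same wall point, so the two fluxes can be subtracted under one
    integral. *)
Lemma dup_max N (j : 'I_N) (z : 'rV[R]_N) :
  insert (lift ord_max j) (z 0 j) z = dup j z.
Proof.
apply/rowP => k; have jN := ltn_ord j; rewrite !mxE.
case: unliftP => [a ->|->]; case: unliftP => [b|] //= /(congr1 val) /=;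
  rewrite /bump => E; congr (z 0 _); apply: val_inj => /=; lia.
Qed.

Lemma dup_closed_weyl N (j : 'I_N) (z : 'rV[R]_N) :
  closed_weyl R N z -> closed_weyl R N.+1 (dup j z).
Proof.
move=> zW; apply: closed_weyl_insert => // l; rewrite /dup.
  case: unliftP => // l' E [<-].
  case: (ltngtP j l') => jl; [exact: zW| |by rewrite (val_inj jl)].
  have lN := ltn_ord l'; move: E => /(congr1 val) /=; rewrite /bump => EE; exfalso; simpl in *; lia.
by rewrite liftK => -[->].
Qed.

End duplication.

Section divergence.
Context {R : realType}.

Lemma closed_closed_weyl n : closed (closed_weyl R n).
Proof.
rewrite (_ : closed_weyl R n = \bigcap_(ij in [set ij : 'I_n * 'I_n | (ij.1 < ij.2)%N])
   ((fun x : 'rV[R]_n => x 0 ij.1 - x 0 ij.2) @^-1` [set t | 0 <= t])).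
  apply: closed_bigI => ij _; apply: closed_comp; last exact: closed_ge.
  by move=> x _; apply: continuousB; exact: coord_continuous.
apply/seteqP; split=> x /=.
  by move=> xW [i j] /= ij; rewrite subr_ge0; exact: xW.
by move=> xW i j ij; rewrite -subr_ge0; exact: (xW (i, j)).
Qed.

Lemma bounded_on_closed_weyl n (f : 'rV[R]_n -> R) (M : R) :
  (forall y, closed_weyl R n y -> {for y, continuous f}) ->
  (forall y, closed_weyl R n y -> M < `|y| -> f y = 0) ->
  exists2 K, 0 <= K & forall y, closed_weyl R n y -> `|f y| <= K.
Proof.
move=> cf f0; pose A := closed_weyl R n `&` [set y | `|y| <= M].
have cA : compact A.
  apply: bounded_closed_compact.
    by exists M; split; [exact: num_real|move=> r Mr y [_ /le_trans]; apply; exact: ltW].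
  apply: closedI; first exact: closed_closed_weyl.
  apply: (@closed_comp _ _ (fun y : 'rV[R]_n => `|y|) [set t | t <= M]).
    by move=> y _; exact: norm_continuous.
  exact: closed_le.
have : compact (f @` A).
  apply: continuous_compact => //; apply: continuous_in_subspaceT => y.
  by rewrite inE => -[yW _]; exact: cf.
move/compact_bounded => [K0 [_ fK]]; exists (`|K0| + 1) => // y yW.
have [yM|yM] := leP `|y| M; last by rewrite f0// normr0.
by apply: (fK (`|K0| + 1)); [rewrite ltr_pwDr// ler_norm|exists y].
Qed.

Lemma coord_le_norm n (y : 'rV[R]_n) i : `|y 0 i| <= `|y|.
Proof. by rewrite /Num.norm/= mx_normrE; exact: (le_bigmax _ _ (0, i)). Qed.

Lemma enorm_le_norm n (y : 'rV[R]_n) : enorm y <= n%:R * `|y|.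
Proof.
rewrite -[leRHS]ger0_norm ?mulr_ge0// -sqrtr_sqr ler_sqrt ?sqr_ge0//.
apply: (@le_trans _ _ (\sum_(i < n) `|y| ^+ 2)).
  apply: ler_sum => i _; rewrite -expr2 -real_normK ?num_real//.
  by rewrite lerXn2r ?nnegrE// coord_le_norm.
rewrite sumr_const card_ord -[leLHS]mulr_natl exprMn ler_wpM2r ?sqr_ge0//.
by rewrite -natrX ler_nat; case: n {y} => // n; rewrite -[leqLHS]expn1 leq_pexp2l.
Qed.

Lemma integrable_bounded_support n (f : 'rV[R]_n -> R) (M : R) :
  (forall y, closed_weyl R n y -> {for y, continuous f}) ->
  (forall y, closed_weyl R n y -> M < `|y| -> f y = 0) ->
  (lebesgue_rV R n).-integrable (weyl R n) (EFin \o f).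
Proof.
move=> cf f0; have [K K0 fK] := bounded_on_closed_weyl cf f0.
(* On the support the Euclidean norm is at most n M, so the factor exp(n M) compensates the decay
   exp(-|y|) there. *)
apply: (@integrable_le_exp _ _ _ _ (K * expR (n%:R * M)) 1) => //.
- exact: measurable_weyl.
- by apply: measurable_fun_open; [exact: open_weyl|move=> y /weyl_sub/cf].
move=> y /weyl_sub yW; have [yM|yM] := leP `|y| M; last first.
  by rewrite f0// normr0 !mulr_ge0 ?expR_ge0.
rewrite -mulrA -expRD (le_trans (fK _ yW))// ler_peMr// mulN1r.
rewrite -[leLHS]expR0 ler_expR subr_ge0 (le_trans (enorm_le_norm y))//.
by rewrite ler_wpM2l.
Qed.

Lemma derive_out_support n (f : 'rV[R]_n -> R) (M : R) (v : 'rV[R]_n) :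
  (forall x, M < `|x| -> f x = 0) -> forall x, M < `|x| -> 'D_v f x = 0.
Proof.
move=> f0 x Mx; rewrite -(derive_cst (0 : R) x v); apply: near_eq_derive.
have : nbhs x [set z | M < `|z|].
  apply: open_nbhs_nbhs; split => //.
  apply: (@open_comp _ _ (fun z : 'rV[R]_n => `|z|) [set t | M < t]).
    by move=> z _; exact: norm_continuous.
  exact: open_gt.
by apply: filterS => z /f0.
Qed.

Variables (N : nat) (i : 'I_N.+1) (F dF : 'rV[R]_N.+1 -> R) (M : R).
Hypothesis F' : forall y, closed_weyl R N.+1 y -> is_derive y (delta_mx 0 i) F (dF y).
Hypothesis cdF : forall y, closed_weyl R N.+1 y -> {for y, continuous dF}.
Hypothesis F0 : forall y, M < `|y| -> F y = 0.

Let dF0 y : closed_weyl R N.+1 y -> M < `|y| -> dF y = 0.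
Proof. by move=> yW My; have [_ <-] := F' yW; exact: (derive_out_support _ F0). Qed.

(* The section of the chamber in direction i is ]z_i, z_(i-1)[; a missing
   neighbour is replaced by a bound beyond the support of F. *)
Let bnd (o : option 'I_N) (d : R) (z : 'rV[R]_N) := oapp (z 0) d o.
Let lo z := bnd (unlift ord_max i) (- (`|M| + 1 + `|z|)) z.
Let hi z := bnd (unlift ord0 i) (`|M| + 1 + `|z|) z.
Let flux z := oapp (fun j => F (dup j z)) 0 (unlift ord0 i)
            - oapp (fun j => F (dup j z)) 0 (unlift ord_max i).

(** The term |z| in the artificial bounds puts them beyond an existing neighbour on the other side;
    the 1 keeps the interval nondegenerate when both neighbours are missing. *)
Let lo_lt_hi z : weyl R N z -> lo z < hi z.
Proof.
move=> zW; rewrite /lo /hi /bnd; case: unliftP => [j|] ij; case: unliftP => [l|] il /=.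
- apply: zW; have := ltn_ord j; move: il => /(congr1 val).
  by rewrite ij /= /bump; simpl in *; lia.
- have := ler_norm (z 0 j); have := coord_le_norm z j.
  by have := normr_ge0 M; lra.
- have := ler_normr (- z 0 l) (z 0 l); have := coord_le_norm z l.
  have := normr_ge0 M; have := ler_norm (- z 0 l); rewrite normrN; lra.
- have := normr_ge0 M; have := normr_ge0 z; lra.
Qed.

Let dline z x : closed_weyl R N.+1 (insert i x z) ->
  is_derive x 1 (fun t => F (insert i t z)) (dF (insert i x z)).
Proof.
move=> yW; under eq_fun do rewrite (insertE i _ 0 z) subr0.
apply: is_derive_line; rewrite -[X in _ *: X]/(delta_mx 0 i).
have E : insert i 0 z + x *: delta_mx 0 i = insert i x z.
  by rewrite (insertE i x 0 z) subr0.
by rewrite E; exact: F'.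
Qed.

Let F_out z x : `|M| + 1 + `|z| <= `|x| -> M < `|insert i x z|.
Proof.
move=> xM; have := coord_le_norm (insert i x z) i; rewrite insert_same.
by have := ler_norm M; have := normr_ge0 z; lra.
Qed.

Let closed_lohi z x : weyl R N z -> lo z <= x -> x <= hi z ->
  closed_weyl R N.+1 (insert i x z).
Proof.
move=> /weyl_sub zW lox xhi; apply: closed_weyl_insert => // j ij.
  by move: lox; rewrite /lo ij.
by move: xhi; rewrite /hi ij.
Qed.

Let F_hi z : F (insert i (hi z) z) = oapp (fun j => F (dup j z)) 0 (unlift ord0 i).
Proof.
rewrite /hi /bnd; case: unliftP => [j|] ij /=; first by rewrite ij.
by apply/F0/F_out; rewrite ler_norm.
Qed.

Let F_lo z : F (insert i (lo z) z) = oapp (fun j => F (dup j z)) 0 (unlift ord_max i).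
Proof.
rewrite /lo /bnd; case: unliftP => [j|] ij /=; first by rewrite ij dup_max.
by apply/F0/F_out; rewrite normrN ler_norm.
Qed.

(** The section of the chamber and the interval from [lo z] to [hi z] can differ only beyond an
    artificial bound, where [dF] vanishes. *)
Let patch_insert z x : weyl R N z ->
  (dF \_ (weyl R N.+1)) (insert i x z) = ((fun t => dF (insert i t z)) \_ `]lo z, hi z[) x.
Proof.
move=> zW; rewrite !patchE; case: ifPn => [|]; rewrite ?inE => yW.
  case: ifPn => //; rewrite notin_setE/= in_itv/= => nx.
  have [Mx|xM] := leP (`|M| + 1 + `|z|) `|x|; first by rewrite dF0 ?F_out//; exact: weyl_sub.
  case/(weyl_insertP i x zW) : yW => xlo xhi; exfalso; apply: nx.
  move: xM; rewrite ltr_norml => /andP[x1 x2].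
  rewrite /lo /hi /bnd; case E : (unlift _ i) => [j|] /=; case E' : (unlift _ i) => [l|] /=;
    by rewrite ?xlo ?xhi ?x1 ?x2.
case: ifPn => //; rewrite inE/= in_itv/= => /andP[x1 x2]; exfalso.
move: yW; rewrite notin_setE; apply; apply/weyl_insertP => //; split=> j ij.
  by move: x1; rewrite /lo ij.
by move: x2; rewrite /hi ij.
Qed.

Let cline z x : closed_weyl R N.+1 (insert i x z) ->
  {for x, continuous (fun t => dF (insert i t z))}.
Proof.
move=> yW; apply: (@continuous_comp _ _ _ (fun t => insert i t z) dF); last exact: cdF.
rewrite (_ : (fun t => insert i t z) = (fun t => insert i 0 z + t *: delta_mx 0 i)).
  by apply: continuousD; [exact: cst_continuous|exact: scalel_continuous].
by apply/funext => t; rewrite (insertE i t 0 z) subr0.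
Qed.

Let integral_line z : weyl R N z ->
  (\int[lebesgue_measure]_x ((dF \_ (weyl R N.+1)) (insert i x z))%:E = (flux z)%:E)%E.
Proof.
move=> zW; have lh := lo_lt_hi zW.
pose g (t : measurableTypeR R) := dF (insert i t z).
rewrite (eq_integral ((EFin \o g) \_ (`]lo z, hi z[%classic : set (measurableTypeR R)))); last first.
  by move=> x _; rewrite patch_insert// restrict_EFin.
(* The endpoints are null; they are added because the fundamental theorem is stated on a closed
   interval. *)
rewrite -integral_mkcond -(@integral_itv_bndoo _ _ _ _ true false); last first.
  apply/measurable_EFinP; apply: open_continuous_measurable_fun => // x.
  rewrite inE/= in_itv/= => /andP[x1 x2].
  by apply/cline/closed_lohi => //; exact: ltW.
rewrite /flux -F_hi -F_lo EFinB.
have cg x : lo z <= x -> x <= hi z -> {for x, continuous (fun t => F (insert i t z))}.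
  move=> x1 x2; apply/differentiable_continuous/derivable1_diffP.
  by have [] := dline (closed_lohi zW x1 x2).
apply: (@continuous_FTC2 _ _ (fun t => F (insert i t z))) => //.
- apply: continuous_in_subspaceT => x; rewrite inE/= in_itv/= => /andP[x1 x2].
  exact/cline/closed_lohi.
- split.
  + move=> x; rewrite in_itv/= => /andP[/ltW x1 /ltW x2].
    by have [] := dline (closed_lohi zW x1 x2).
  + by apply: cvg_at_right_filter; apply: cg => //; exact: ltW.
  + by apply: cvg_at_left_filter; apply: cg => //; exact: ltW.
- move=> x; rewrite in_itv/= => /andP[/ltW x1 /ltW x2]; rewrite derive1E.
  by have [] := dline (closed_lohi zW x1 x2).
Qed.

(** Fubini puts coordinate i innermost, and the fundamental theorem of calculus evaluates each
    section. An endpoint at a neighbour is a wall point [dup j z]; a missing neighbour contributes 0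
    because F vanishes at the artificial bound. *)
Lemma integral_partial_weyl :
  (\int[lebesgue_rV R N.+1]_(y in weyl R N.+1) (dF y)%:E =
   \int[lebesgue_rV R N]_(z in weyl R N)
     (oapp (fun j => F (dup j z)) 0 (unlift ord0 i)
      - oapp (fun j => F (dup j z)) 0 (unlift ord_max i))%:E)%E.
Proof.
have intdF := integrable_bounded_support cdF dF0.
rewrite integral_mkcond (integral_insert i); last first.
  by apply/(integrable_mkcond _ (measurable_weyl R _)).
rewrite [RHS]integral_mkcond; apply: eq_integral => z _; rewrite [RHS]patchE.
under eq_integral do rewrite restrict_EFin/=.
case: ifPn => [|]; rewrite ?inE => zW; first exact: integral_line.
apply: integral0_eq => x _; rewrite patchE memNset//.
by move=> /weyl_insert_inv yW; move: zW; rewrite notin_setE.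
Qed.

End divergence.

(** * Directional derivatives of C^1 functions *)

Section directional.
Context {R : realType}.

Lemma mean_value_bound (g dg : R -> R) (D e s : R) :
  (forall t : R, `|t| <= `|s| -> is_derive t 1 g (dg t)) ->
  (forall t : R, `|t| <= `|s| -> `|dg t - D| <= e) ->
  `|g s - g 0 - s * D| <= e * `|s|.
Proof.
move=> g' dgD.
have cg a b : `|a| <= `|s| -> `|b| <= `|s| -> {within `[a, b], continuous g}.
  move=> sa sb; apply: continuous_in_subspaceT => t; rewrite inE/= in_itv/= => /andP[at_ tb].
  apply/differentiable_continuous/derivable1_diffP.
  have [|//] := g' t.
  move: sa sb; rewrite !ler_norml => /andP[sa _] /andP[_ sb].
  by rewrite (le_trans sa)//= (le_trans tb).
have dg' a b : `|a| <= `|s| -> `|b| <= `|s| -> forall t : R, t \in `]a, b[ -> is_derive t 1 g (dg t).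
  move=> sa sb t; rewrite in_itv/= => /andP[/ltW at_ /ltW tb]; apply: g'.
  move: sa sb; rewrite !ler_norml => /andP[sa _] /andP[_ sb].
  by rewrite (le_trans sa)//= (le_trans tb).
have s0 : `|0 : R| <= `|s| by rewrite normr0.
have [s_ge0|/ltW s_le0] := leP 0 s.
- have [t] := MVT_segment s_ge0 (dg' _ _ s0 (lexx _)) (cg _ _ s0 (lexx _)).
  rewrite in_itv/= => /andP[t0 ts] ->; rewrite subr0 mulrC -mulrBr normrM mulrC.
  by rewrite ler_wpM2r// dgD// !ger0_norm.
- have [t] := MVT_segment s_le0 (dg' _ _ (lexx _) s0) (cg _ _ (lexx _) s0).
  rewrite in_itv/= => /andP[st t0] E.
  have -> : g s - g 0 = dg t * s by rewrite -opprB E sub0r mulrN opprK.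
  rewrite mulrC -mulrBr normrM mulrC.
  by rewrite ler_wpM2r// dgD// !ler0_norm// lerN2.
Qed.

(** [C_on] speaks of partial derivatives only, so derivatives in general directions are assembled
    one coordinate at a time. The increment along d + c w is split at p + h d: the first piece has
    derivative l, and the second runs along w, where the mean value bound applies because the
    derivative along w is continuous at p. *)
Lemma is_derive_addl (V : normedModType R) (f : V -> R) (p d w : V) (c l : R) :
  (\forall x \near p, derivable f x w) -> {for p, continuous ('D_w f)} ->
  is_derive p d f l -> is_derive p (d + c *: w) f (l + c * 'D_w f p).
Proof.
move=> dw cD [df fl].
have H : (fun h : R => h^-1 *: ((f \o shift p) (h *: (d + c *: w)) - f p)) @ 0^' -->
    l + c * 'D_w f p.
  rewrite (_ : (fun h => _) = (fun h : R => h^-1 *: ((f \o shift p) (h *: d) - f p) +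
     h^-1 *: (f (h *: d + p + (h * c) *: w) - f (h *: d + p)))); last first.
    apply/funext => h; rewrite -scalerDr; congr (_ *: _).
    rewrite /= [in RHS]addrC addrA subrK scalerDr scalerA; congr (f _ - _).
    by rewrite addrAC.
  apply: cvgD; first by rewrite -fl; exact: df.
  apply/cvgrPdist_le => e e0.
  (* The second piece has length parameter |h c|, so an error e' per unit costs at most e |h|; the 1
     keeps the divisor positive when c = 0. *)
  pose e' := e / (`|c| + 1).
  have c0 : 0 < `|c| + 1 by rewrite ltr_pwDr.
  have e'0 : 0 < e' by rewrite divr_gt0.
  have : \forall x \near p, derivable f x w /\ `|'D_w f p - 'D_w f x| <= e'.
    near=> x; split; first by near: x.
    by near: x; move/cvgrPdist_le : cD; apply.
  move=> /nbhs_ballP[r /= r0 pr].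
  (* |h| K bounds every displacement h d + t w with |t| at most |h c|, so the whole segment stays in
     the ball. *)
  pose K := `|d| + `|c| * `|w| + 1.
  have K0 : 0 < K by rewrite ltr_pwDr// addr_ge0// mulr_ge0.
  have hr : \forall h \near (0:R)^', h != 0 /\ `|h| * K < r.
    near=> h; split; first by near: h; exact: nbhs_dnbhs_neq.
    rewrite -ltr_pdivlMr//; near: h; apply: dnbhs0_lt; exact: divr_gt0.
  apply: filterS hr => h [h0 hK].
  have inball t : `|t| <= `|h * c| -> ball p r (h *: d + p + t *: w).
    move=> tc; rewrite -ball_normE /= [h *: d + p]addrC -addrA opprD addrA subrr sub0r normrN.
    apply: le_lt_trans hK; apply: (le_trans (ler_normD _ _)); rewrite !normrZ.
    apply: (@le_trans _ _ (`|h| * `|d| + `|h| * (`|c| * `|w|))).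
      by rewrite lerD2l mulrA -normrM ler_wpM2r.
    by rewrite -mulrDr ler_wpM2l// /K lerDl.
  have := @mean_value_bound (fun t => f (h *: d + p + t *: w))
    (fun t => 'D_w f (h *: d + p + t *: w)) ('D_w f p) e' (h * c) _ _.
  rewrite scale0r addr0 => B.
  have {}B := B (fun t tc => is_derive_line (derivableP (pr _ (inball t tc)).1))
    (fun t tc => eq_ind _ (fun u => u <= e') (pr _ (inball t tc)).2 _ (distrC _ _)).
  rewrite (_ : _ - _ = - (h^-1 * (f (h *: d + p + (h * c) *: w) - f (h *: d + p)
      - h * c * 'D_w f p))); last first.
    set A := f _; set B' := f _.
    have -> : h^-1 *: (A - B') = h^-1 * (A - B') :> R by [].
    by move: A B' => A B'; field.
  rewrite normrN normrM normfV ler_pdivrMl ?normr_gt0//.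
  apply: (le_trans B); rewrite normrM mulrCA ler_wpM2l//.
  rewrite /e' mulrAC ler_pdivrMr//; rewrite ler_wpM2l ?ltW//; lra.
by split; [apply: cvgP H|exact: cvg_lim H].
Unshelve. all: by end_near. Qed.

Lemma C1_is_derive n (U : set 'rV[R]_n) (f : 'rV[R]_n -> R) (x d : 'rV[R]_n) :
  open U -> C_on 1 U f -> U x -> is_derive x d f (\sum_i d 0 i * partial i f x).
Proof.
move=> oU [_ f1] Ux; rewrite {1}(row_sum_delta d).
have Uxn : nbhs x U by exact: open_nbhs_nbhs.
elim: (index_enum _) => [|i s IH]; first by rewrite !big_nil; exact: is_derive0.
rewrite !big_cons [X in is_derive _ X]addrC [X in is_derive _ _ _ X]addrC.
have [fi [ci _]] := f1 i.
apply: is_derive_addl => //; last exact: ci.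
by apply: filterS Uxn => y; exact: fi.
Qed.

End directional.

Section selection.
Context {R : realType}.

(** Embedding a face and duplicating a coordinate are both of this form, which yields the continuity
    of both and the chain rule for the embedding. *)
Definition select a b (phi : 'I_a -> 'I_b) (z : 'rV[R]_b) : 'rV[R]_a :=
  \row_k z 0 (phi k).

Lemma mx_norm_leP n (y : 'rV[R]_n) (K : R) : 0 <= K ->
  (forall i, `|y 0 i| <= K) -> `|y| <= K.
Proof.
move=> K0 yK; rewrite /Num.norm/= mx_normrE; apply/bigmax_leP; split => // -[i j] _ /=.
by rewrite ord1.
Qed.

Variables (a b : nat) (phi : 'I_a -> 'I_b).

Lemma select_norm (z : 'rV[R]_b) : `|select phi z| <= `|z|.
Proof. by apply: mx_norm_leP => // i; rewrite mxE coord_le_norm. Qed.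

Lemma selectB (y z : 'rV[R]_b) : select phi (y - z) = select phi y - select phi z.
Proof. by apply/rowP => i; rewrite !mxE. Qed.

Lemma select_linear (c : R) (y z : 'rV[R]_b) :
  select phi (c *: y + z) = c *: select phi y + select phi z.
Proof. by apply/rowP => i; rewrite !mxE. Qed.

Lemma continuous_select : continuous (select phi).
Proof.
move=> y A /nbhs_ballP[e /= e0 eA]; apply/nbhs_ballP; exists e => // z yz.
apply: eA; move: yz; rewrite -!ball_normE /= -selectB.
by apply: le_lt_trans; exact: select_norm.
Qed.

Hypothesis phi_surj : forall j, exists i, phi i = j.

Lemma norm_select_ge (z : 'rV[R]_b) : `|z| <= `|select phi z|.
Proof.
apply: mx_norm_leP => // j; have [i <-] := phi_surj j.
by have := coord_le_norm (select phi z) i; rewrite mxE.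
Qed.

(** A section of [phi] finds every coordinate of z at its own place in [select phi z]. The
    inequality carries exponential decay in the ambient space over to the coordinates of a face. *)
Lemma enorm_select_ge (z : 'rV[R]_b) : enorm z <= enorm (select phi z).
Proof.
rewrite ler_sqrt ?dot_ge0// /dot.
pose psi j := sval (cid (phi_surj j)).
have psiK j : phi (psi j) = j by rewrite /psi; case: cid.
have psi_inj : injective psi by move=> j l jl; rewrite -(psiK j) jl psiK.
rewrite [leRHS](bigID (mem (codom psi)))/= -[leLHS]addr0 lerD//; last first.
  by apply: sumr_ge0 => i _; rewrite -expr2 sqr_ge0.
rewrite -big_uniq/=; last by rewrite map_inj_uniq// enum_uniq.
rewrite big_map big_enum/=; apply: ler_sum => j _.
by rewrite !mxE psiK.
Qed.

End selection.

(** * Faces and sets of cuts *)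

Section cuts.
Variable m : nat.
Implicit Types S : {set 'I_m}.

(* An ordered partition of {0..m} into intervals is encoded by its set of cuts:
   s is a cut when s and s + 1 lie in different blocks. The block of i is then
   numbered by the cuts below i. *)
Definition idx S (i : nat) : nat := #|[set s in S | (s < i)%N]|.

Lemma idx0 S : idx S 0 = 0%N.
Proof. by apply/eqP; rewrite cards_eq0; apply/eqP/setP => s; rewrite !inE andbF. Qed.

Lemma idx_all S : idx S m = #|S|.
Proof. by apply: eq_card => s; rewrite !inE ltn_ord andbT. Qed.

Lemma idx_mono S i j : (i <= j)%N -> (idx S i <= idx S j)%N.
Proof.
move=> ij; apply: subset_leq_card; apply/fintype.subsetP => s; rewrite !inE => /andP[-> si].
exact: leq_trans si ij.
Qed.

Lemma idx_le S (i : 'I_m.+1) : (idx S i <= #|S|)%N.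
Proof. by rewrite -(idx_all S) idx_mono// -ltnS. Qed.

Lemma idxS S (s : 'I_m) : idx S s.+1 = ((s \in S) + idx S s)%N.
Proof.
rewrite /idx (cardsD1 s) !inE ltnSn andbT; congr (_ + _)%N.
apply: eq_card => t; rewrite !inE ltnS leq_eqVlt -val_eqE/=.
by case: ltngtP; rewrite ?andbF ?andbT.
Qed.

Lemma idx_setU1 S (s : 'I_m) (i : nat) : s \notin S ->
  idx (s |: S)%SET i = (idx S i + (s < i))%N.
Proof.
move=> sS; rewrite /idx; case: (ltnP s i) => si; last first.
  rewrite addn0; apply: eq_card => t; rewrite !inE.
  by case: eqP => //= ->; rewrite ltnNge si andbF.
rewrite (cardsD1 s) !inE eqxx si addn1 add1n; congr _.+1.
apply: eq_card => t; rewrite !inE.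
by case: eqP => //= ->; rewrite (negbTE sS).
Qed.

(** A discrete intermediate value argument: [idx S] starts at 0, ends at #|S| and grows by at most 1
    per step. Hence no block is empty. *)
Lemma idx_surj S j : (j <= #|S|)%N -> exists i : 'I_m.+1, idx S i = j.
Proof.
rewrite -(idx_all S).
have H k : (k <= m)%N -> (j <= idx S k)%N -> exists i : 'I_m.+1, idx S i = j.
  elim: k => [|k IH] km.
    by rewrite idx0 leqn0 => /eqP ->; exists ord0; rewrite idx0.
  have /= -> := idxS S (Ordinal km).
  rewrite leq_eqVlt => /predU1P[->|jk].
    by exists (Ordinal (km : (k.+1 < m.+1)%N)); rewrite -(idxS S (Ordinal km)).
  apply: IH; first exact: ltnW.
  by rewrite -ltnS (leq_trans jk)// -add1n leq_add2r leq_b1.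
exact: H.
Qed.

(** On S itself [idx S] numbers the cuts in increasing order: the cut s is the wall between blocks
    [idx S s] and [idx S s + 1]. *)
Lemma sum_idx (V : nmodType) S (f : nat -> V) :
  \sum_(s in S) f (idx S s) = \sum_(j < #|S|) f j.
Proof.
have H k : (k <= m)%N -> \sum_(s in S | (s < k)%N) f (idx S s) = \sum_(j < idx S k) f j.
  elim: k => [|k IH] km.
    by rewrite idx0 big_ord0 big_pred0// => s; rewrite andbF.
  have /= -> := idxS S (Ordinal km).
  have E : \sum_(s in S | (s < k)%N) f (idx S s) =
      \sum_(s in S | (s < k.+1)%N && (s != Ordinal km)) f (idx S s).
    apply: eq_bigl => s; congr (_ && _).
    by rewrite -val_eqE/= ltnS ltn_neqAle andbC.
  case: (boolP (Ordinal km \in S)) => kS.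
    rewrite (bigD1 (Ordinal km)) ?kS ?ltnSn//= add1n big_ord_recr/= addrC; congr (_ + _).
    by rewrite -IH ?(ltnW km)// E; apply: eq_bigl => s; rewrite andbA.
  rewrite add0n -IH ?(ltnW km)// E; apply: eq_bigl => s.
  case: (boolP (s \in S)) => //= sS; case: (_ < _)%N => //=.
  by apply/esym; apply: contraNneq kS => <-.
rewrite -[in RHS]idx_all -H//; apply: eq_bigl => s; by rewrite ltn_ord andbT.
Qed.

End cuts.

Section embedding.
Context {R : realType} (m : nat).
Implicit Types S : {set 'I_m}.

(** N is a separate argument because the cardinal of a set such as [S :\ s] equals the wanted
    dimension only by a proof. When #|S| = N, every [idx S i] is in range and [inord] does not alter
    it. *)
Definition emb S N : 'rV[R]_N.+1 -> 'rV[R]_m.+1 :=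
  select (fun i : 'I_m.+1 => inord (idx S i) : 'I_N.+1).

Lemma emb_surj S N : #|S| = N ->
  forall j : 'I_N.+1, exists i : 'I_m.+1, inord (idx S i) = j :> 'I_N.+1.
Proof.
move=> SN j; have [|i ij] := @idx_surj _ S j; first by rewrite SN -ltnS.
by exists i; rewrite ij inord_val.
Qed.

Lemma inord_idxE S N (i : 'I_m.+1) : #|S| = N -> (inord (idx S i) : 'I_N.+1) = idx S i :> nat.
Proof. by move=> SN; rewrite inordK// ltnS -SN idx_le. Qed.

Lemma emb_closed_weyl S N (y : 'rV[R]_N.+1) : #|S| = N ->
  closed_weyl R N.+1 y -> closed_weyl R m.+1 (emb S y).
Proof.
move=> SN yW i j ij; rewrite !mxE.
have : (idx S i <= idx S j)%N by rewrite idx_mono// ltnW.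
rewrite leq_eqVlt => /predU1P[->//|ij'].
by apply: yW; rewrite !inord_idxE.
Qed.

Lemma dupE N (j : 'I_N.+1) (z : 'rV[R]_N.+1) (k : 'I_N.+2) :
  dup j z 0 k = z 0 (inord (k - (j < k)%N)).
Proof.
rewrite mxE; case: unliftP => [l ->|->] /=; congr (z 0 _); apply: val_inj => /=;
  rewrite /bump leq0n add1n.
- have lN : (l < N.+1)%N := ltn_ord l.
  case: (leqP j.+1 l) => jl.
    by rewrite add1n ltnS (ltnW jl) subn1 inordK.
  by rewrite add0n ltnNge -ltnS jl subn0 inordK.
- by rewrite ltnSn subn1 inordK// ltn_ord.
Qed.

(** The wall of the face [s |: S] at the cut s is the face S: equating the coordinates of the two
    halves undoes the split. *)
Lemma emb_dup S N (s : 'I_m) (z : 'rV[R]_N.+1) : s \notin S -> #|S| = N ->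
  emb (s |: S)%SET (dup (inord (idx S s)) z) = emb S z.
Proof.
move=> sS SN; have sN : (idx S s <= N)%N by rewrite -SN -(idx_all S) idx_mono// ltnW.
apply/rowP => i; rewrite mxE dupE mxE idx_setU1//; congr (z 0 (inord _)).
have iN : (idx S i <= N)%N by rewrite -SN idx_le.
rewrite !inordK ?ltnS//; last by case: (s < i)%N; rewrite ?addn0 ?addn1 ?ltnS// leqW.
case: (ltnP s i) => si; last first.
  by rewrite addn0 ltnNge idx_mono// subn0.
by rewrite addn1 ltnS idx_mono ?subn1// ltnW.
Qed.

End embedding.

(** * Flux through the faces *)

Section weyl_integral.
Context {R : realType}.

(** Real-valued, so that boundary terms can be subtracted and cancelled; [wintegrable] ensures that
    it agrees with the extended integral. *)
Definition wint n (f : 'rV[R]_n -> R) : R :=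
  (\int[lebesgue_rV R n]_(y in weyl R n) f y)%R.

Definition wintegrable n (f : 'rV[R]_n -> R) : Prop :=
  (lebesgue_rV R n).-integrable (weyl R n) (EFin \o f).

Definition wcont n (f : 'rV[R]_n -> R) : Prop :=
  forall y, closed_weyl R n y -> {for y, continuous f}.

Variable n : nat.
Implicit Types f g : 'rV[R]_n -> R.

Lemma eq_wint f g : (forall y, weyl R n y -> f y = g y) -> wint f = wint g.
Proof. by move=> fg; apply: eq_Rintegral => y; rewrite inE => /fg. Qed.

Lemma eq_wintegrable f g : (forall y, weyl R n y -> f y = g y) ->
  wintegrable f -> wintegrable g.
Proof.
move=> fg; apply: eq_integrable; first exact: measurable_weyl.
by move=> y; rewrite inE => /fg /= ->.
Qed.

Lemma wintE f : wintegrable f ->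
  (\int[lebesgue_rV R n]_(y in weyl R n) (f y)%:E)%E = (wint f)%:E.
Proof.
by move=> fi; rewrite /wint /Rintegral fineK//; exact: (integrable_fin_num (measurable_weyl R n)).
Qed.

Lemma wintegrableD f g : wintegrable f -> wintegrable g ->
  wintegrable (fun y => f y + g y).
Proof.
by move=> fi gi; apply: (integrableD (measurable_weyl R n) fi gi).
Qed.

Lemma wintegrableZ c f : wintegrable f -> wintegrable (fun y => c * f y).
Proof. by move=> fi; apply: (integrableZl (measurable_weyl R n) c fi). Qed.

Lemma wintD f g : wintegrable f -> wintegrable g ->
  wint (fun y => f y + g y) = wint f + wint g.
Proof. exact: (RintegralD (measurable_weyl R n)). Qed.

Lemma wintB f g : wintegrable f -> wintegrable g ->
  wint (fun y => f y - g y) = wint f - wint g.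
Proof. exact: (RintegralB (measurable_weyl R n)). Qed.

Lemma wintZ c f : wintegrable f -> wint (fun y => c * f y) = c * wint f.
Proof. exact: (RintegralZl _ (measurable_weyl R n)). Qed.

Lemma wintegrable0 : @wintegrable n (fun=> 0).
Proof. exact: integrable0. Qed.

Lemma wint0 : @wint n (fun=> 0) = 0.
Proof. by rewrite /wint /Rintegral integral0. Qed.

Let sum_nil (I : Type) (P : pred I) (F : I -> 'rV[R]_n -> R) :
  (fun y => \sum_(i <- [::] | P i) F i y) = fun=> 0.
Proof. by apply/funext => y; rewrite big_nil. Qed.

Let sum_cons (I : Type) i (r : seq I) (P : pred I) (F : I -> 'rV[R]_n -> R) :
  (fun y => \sum_(i <- i :: r | P i) F i y) = if P i
    then fun y => F i y + \sum_(i <- r | P i) F i y else fun y => \sum_(i <- r | P i) F i y.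
Proof. by apply/funext => y; rewrite big_cons; case: ifP. Qed.

Lemma wint_sum (I : Type) (r : seq I) (P : pred I) (F : I -> 'rV[R]_n -> R) :
  (forall i, P i -> wintegrable (F i)) ->
  wintegrable (fun y => \sum_(i <- r | P i) F i y) /\
  wint (fun y => \sum_(i <- r | P i) F i y) = \sum_(i <- r | P i) wint (F i).
Proof.
move=> Fi; elim: r => [|i r [IH1 IH2]].
  by rewrite sum_nil big_nil; split; [exact: wintegrable0|exact: wint0].
rewrite sum_cons big_cons.
case: ifPn => Pi //; split; first exact: wintegrableD (Fi i Pi) IH1.
by rewrite wintD ?IH2//; exact: Fi.
Qed.

Lemma wcont_cst (c : R) : @wcont n (fun=> c).
Proof. by move=> y _; exact: cst_continuous. Qed.

Lemma wcontD f g : wcont f -> wcont g -> wcont (fun y => f y + g y).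
Proof. by move=> cf cg y yW; apply: continuousD; [exact: cf|exact: cg]. Qed.

Lemma wcontN f : wcont f -> wcont (fun y => - f y).
Proof. by move=> cf y yW; apply: continuousN; exact: cf. Qed.

Lemma wcontM f g : wcont f -> wcont g -> wcont (fun y => f y * g y).
Proof. by move=> cf cg y yW; apply: continuousM; [exact: cf|exact: cg]. Qed.

Lemma wcont_sum (I : Type) (r : seq I) (P : pred I) (F : I -> 'rV[R]_n -> R) :
  (forall i, P i -> wcont (F i)) -> wcont (fun y => \sum_(i <- r | P i) F i y).
Proof.
move=> Fi; elim: r => [|i r IH].
  by rewrite sum_nil; exact: wcont_cst.
rewrite sum_cons.
by case: ifPn => Pi //; apply: wcontD => //; exact: Fi.
Qed.

Lemma is_derive_bigsum (I : Type) (r : seq I) (P : pred I)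
    (F : I -> 'rV[R]_n -> R) (dF : I -> R) (y v : 'rV[R]_n) :
  (forall i, P i -> is_derive y v (F i) (dF i)) ->
  is_derive y v (fun y => \sum_(i <- r | P i) F i y) (\sum_(i <- r | P i) dF i).
Proof.
move=> Fi; elim: r => [|i r IH].
  by rewrite sum_nil big_nil; exact: is_derive_cst.
rewrite sum_cons big_cons.
by case: ifPn => Pi //; apply: is_deriveD; exact: Fi.
Qed.

End weyl_integral.

Section flux.
Context {R : realType}.

Lemma C_on_sub n k (U U' : set 'rV[R]_n) (f : 'rV[R]_n -> R) :
  U' `<=` U -> C_on k U f -> C_on k U' f.
Proof.
move=> UU; elim: k f => [|k IH] f [cf df]; (split; first by move=> x /UU; exact: cf) => //.
by move=> i; have [di ci] := df i; split; [move=> x /UU; exact: di|exact: IH].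
Qed.

Lemma C_onS n k (U : set 'rV[R]_n) (f : 'rV[R]_n -> R) : C_on k.+1 U f -> C_on k U f.
Proof.
elim: k f => [|k IH] f [cf df]; split=> // i.
by have [di ci] := df i; split => //; exact: IH.
Qed.

Lemma C_on_partial n k (U : set 'rV[R]_n) (f : 'rV[R]_n -> R) i :
  C_on k.+1 U f -> C_on k U (partial i f).
Proof. by move=> [_ /(_ i)[]]. Qed.

Lemma is_derive_select a b (phi : 'I_a -> 'I_b) (f : 'rV[R]_a -> R) (y v : 'rV[R]_b) (l : R) :
  is_derive (select phi y) (select phi v) f l -> is_derive y v (f \o select phi) l.
Proof.
move=> [df fl].
have E : (fun h : R => h^-1 *: (((f \o select phi) \o shift y) (h *: v) - (f \o select phi) y))
    = (fun h => h^-1 *: ((f \o shift (select phi y)) (h *: select phi v) - f (select phi y))).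
  by apply/funext => h; rewrite /= /shift/= select_linear.
split; first by move: df; rewrite /derivable E.
by move: fl; rewrite /derive E.
Qed.

Variable m : nat.
Implicit Types S : {set 'I_m}.

(* At x = emb S y this is the j-th partial derivative of f \o emb S at y. *)
Definition bd S (j : nat) (f : 'rV[R]_m.+1 -> R) (x : 'rV[R]_m.+1) : R :=
  \sum_(i < m.+1 | idx S i == j) partial i f x.

(** At [emb S y] this is the second derivative in y_j of the pullback of f; its sum over j is the
    Laplacian on the face. *)
Definition bd2 S (j : nat) (f : 'rV[R]_m.+1 -> R) (x : 'rV[R]_m.+1) : R :=
  \sum_(i < m.+1 | idx S i == j) bd S j (partial i f) x.

Lemma is_derive_emb S N (U : set 'rV[R]_m.+1) f (y : 'rV[R]_N.+1) (j : 'I_N.+1) :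
  #|S| = N -> open U -> C_on 1 U f -> U (emb S y) ->
  is_derive y (delta_mx 0 j) (f \o @emb R m S N) (bd S j f (emb S y)).
Proof.
move=> SN oU f1 Uy; apply: is_derive_select.
have := C1_is_derive (select (fun i : 'I_m.+1 => inord (idx S i)) (delta_mx 0 j)) oU f1 Uy.
rewrite (_ : \sum_i _ = bd S j f (emb S y))// /bd [RHS]big_mkcond/=.
apply: eq_bigr => i _; rewrite !mxE eqxx/= -val_eqE/= inord_idxE//.
by case: ifP; rewrite ?mul1r ?mul0r.
Qed.

Section fixed_cuts.
Variables (S : {set 'I_m}) (N : nat) (U : set 'rV[R]_m.+1) (u v : 'rV[R]_m.+1 -> R) (M : R).
Hypotheses (SN : #|S| = N) (oU : open U) (subU : closed_weyl R m.+1 `<=` U).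
Hypotheses (u2 : C_on 2 U u) (v1 : C_on 1 U v).
Hypothesis (v0 : forall x, M < `|x| -> v x = 0).

Lemma wcont_emb (f : 'rV[R]_m.+1 -> R) : C_on 0 U f -> wcont (fun y : 'rV[R]_N.+1 => f (emb S y)).
Proof.
move=> [cf _] y yW.
apply: (@continuous_comp _ _ _ (@emb R m S N) f); first exact: continuous_select.
by apply: cf; apply: subU; exact: emb_closed_weyl.
Qed.

Lemma wcont_bd S' j (f : 'rV[R]_m.+1 -> R) : C_on 1 U f ->
  wcont (fun y : 'rV[R]_N.+1 => bd S' j f (emb S y)).
Proof.
move=> f1; apply: wcont_sum => i _; apply: wcont_emb; exact: C_on_partial.
Qed.

Lemma wcont_bd2 j : wcont (fun y : 'rV[R]_N.+1 => bd2 S j u (emb S y)).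
Proof.
by apply: wcont_sum => i _; apply: wcont_bd; exact: C_on_partial.
Qed.

Lemma norm_emb_ge (y : 'rV[R]_N.+1) : `|y| <= `|emb S y|.
Proof. by apply: norm_select_ge; exact: emb_surj. Qed.

Lemma v_emb0 (y : 'rV[R]_N.+1) : M < `|y| -> v (emb S y) = 0.
Proof. by move=> My; apply: v0; exact: lt_le_trans (norm_emb_ge y). Qed.

(** [F j] is the j-th component of the gradient of the pulled back u times the pulled back v;
    [A j + B j] is its derivative in y_j. *)
Let F (j : nat) (y : 'rV[R]_N.+1) := bd S j u (emb S y) * v (emb S y).
Let A (j : nat) (y : 'rV[R]_N.+1) := bd2 S j u (emb S y) * v (emb S y).
Let B (j : nat) (y : 'rV[R]_N.+1) := bd S j u (emb S y) * bd S j v (emb S y).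

Let wcontF j : wcont (F j).
Proof. by apply: wcontM; [apply: wcont_bd; exact: C_onS|apply: wcont_emb; exact: C_onS]. Qed.

Let wcontA j : wcont (A j).
Proof. by apply: wcontM; [exact: wcont_bd2|apply: wcont_emb; exact: C_onS]. Qed.

Let wcontB j : wcont (B j).
Proof. by apply: wcontM; [apply: wcont_bd; exact: C_onS|apply: wcont_bd]. Qed.

Let F0 j y : M < `|y| -> F j y = 0.
Proof. by move=> /v_emb0; rewrite /F => ->; rewrite mulr0. Qed.

Let A0 j y : M < `|y| -> A j y = 0.
Proof. by move=> /v_emb0; rewrite /A => ->; rewrite mulr0. Qed.

Let B0 j y : M < `|y| -> B j y = 0.
Proof.
move=> My; rewrite /B [X in _ * X]big1 ?mulr0// => i _.
by apply: (derive_out_support _ v0); exact: lt_le_trans My (norm_emb_ge y).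
Qed.

Let F' (j : 'I_N.+1) y : closed_weyl R N.+1 y ->
  is_derive y (delta_mx 0 j) (F j) (A j y + B j y).
Proof.
move=> yW; have Uy : U (emb S y) by apply: subU; exact: emb_closed_weyl.
have du : is_derive y (delta_mx 0 j) (fun y => bd S j u (emb S y)) (bd2 S j u (emb S y)).
  apply: is_derive_bigsum => i _; apply: (is_derive_emb _ SN oU) => //; exact: C_on_partial.
have dv := is_derive_emb j SN oU v1 Uy.
have := is_deriveM du dv.
by rewrite addrC; congr (is_derive _ _ _ (_ + _)); rewrite [LHS]mulrC.
Qed.

Let integrableA j : wintegrable (A j).
Proof. exact: integrable_bounded_support (@wcontA j) (fun y _ => @A0 j y). Qed.

Let integrableB j : wintegrable (B j).
Proof. exact: integrable_bounded_support (@wcontB j) (fun y _ => @B0 j y). Qed.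

Let wcont_F_dup i (j : 'I_N) : wcont (fun z => F i (dup j z)).
Proof.
move=> z zW; apply: (@continuous_comp _ _ _ (dup j) (F i)); last first.
  by apply: wcontF; exact: dup_closed_weyl.
rewrite (_ : dup j = select (fun k => oapp id j (unlift (lift ord0 j) k))).
  exact: continuous_select.
apply/funext => w; apply/rowP => k; rewrite !mxE.
by case: unliftP.
Qed.

Let integrable_F_dup i (j : 'I_N) : wintegrable (fun z => F i (dup j z)).
Proof.
apply: (@integrable_bounded_support _ _ _ M (@wcont_F_dup i j)) => z _ Mz; apply: F0.
apply: (lt_le_trans Mz); apply: mx_norm_leP => // k.
by rewrite -(insert_lift (lift ord0 j) (z 0 j) z k) coord_le_norm.
Qed.

(** The divergence theorem for the field F. The wall y_j = y_(j+1) is the upper end for coordinate j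
    + 1 and the lower end for coordinate j, whence a difference of two normal derivatives. *)
Lemma wint_flux :
  wint (fun y : 'rV[R]_N.+1 => \sum_(j < N.+1) bd2 S j u (emb S y) * v (emb S y)) +
  wint (fun y : 'rV[R]_N.+1 => \sum_(j < N.+1) bd S j u (emb S y) * bd S j v (emb S y)) =
  \sum_(j < N) wint (fun z : 'rV[R]_N =>
    (bd S j.+1 u (emb S (dup j z)) - bd S j u (emb S (dup j z))) * v (emb S (dup j z))).
Proof.
have [_ ->] := @wint_sum R N.+1 'I_N.+1 (index_enum _) predT (fun j => A j) (fun j _ => @integrableA j).
have [_ ->] := @wint_sum R N.+1 'I_N.+1 (index_enum _) predT (fun j => B j) (fun j _ => @integrableB j).
rewrite -big_split/=.
have E (i : 'I_N.+1) : wint (A i) + wint (B i) =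
    oapp (fun j => wint (fun z => F i (dup j z))) 0 (unlift ord0 i)
    - oapp (fun j => wint (fun z => F i (dup j z))) 0 (unlift ord_max i).
  rewrite -wintD//.
  have H := integral_partial_weyl (@F' i) (wcontD (@wcontA i) (@wcontB i)) (@F0 i).
  rewrite /wint /Rintegral H -/(Rintegral _ _ _) -/(wint _).
  have H1 (o : option 'I_N) : wintegrable (fun z => oapp (fun j => F i (dup j z)) 0 o) /\
     wint (fun z => oapp (fun j => F i (dup j z)) 0 o) = oapp (fun j => wint (fun z => F i (dup j z))) 0 o.
    by case: o => [j|] /=; split => //; [exact: wintegrable0|exact: wint0].
  have [i1 w1] := H1 (unlift ord0 i); have [i2 w2] := H1 (unlift ord_max i).
  by rewrite -w1 -w2; exact: wintB.
under eq_bigr do rewrite E.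
(* The first coordinate has no upper wall and the last one no lower wall; without these two terms
   both sums run over the N walls. *)
rewrite sumrB big_ord_recl unlift_none [oapp _ _ None]/= add0r.
rewrite [X in _ - X]big_ord_recr/= unlift_none addr0.
rewrite -sumrB; apply: eq_bigr => j _; rewrite liftK.
have -> : widen_ord (leqnSn N) j = lift ord_max j.
  by apply: val_inj; rewrite /= /bump leqNgt ltn_ord.
rewrite liftK/=.
rewrite -wintB//; apply: eq_wint => z _.
by rewrite /F /= /bump leq0n add1n mulrBl.
Qed.

End fixed_cuts.
End flux.

(** * Splitting a block *)

Section block_weights.
Context {R : realType} (m : nat).
Implicit Types S : {set 'I_m}.

Definition block S (j : nat) : {set 'I_m.+1} := [set i : 'I_m.+1 | idx S i == j]%SET.

Lemma card_itv n (a b : nat) : (b < n)%N -> #|[set i : 'I_n | (a <= i <= b)%N]%SET| = (b.+1 - a)%N.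
Proof.
move=> bn; rewrite -[RHS]muln1 -sum_nat_const_nat (big_nat_widen _ _ _ _ _ bn).
rewrite (big_nat_widenl _ _ _ _ _ (leq0n a)) big_mkord sum1dep_card.
by apply: eq_card => i; rewrite !inE/= ltnS andbC.
Qed.

Lemma block_itv S j : (j <= #|S|)%N -> exists a b : 'I_m.+1,
  [/\ (a <= b)%N, idx S a = j, idx S b = j &
      forall i : 'I_m.+1, (idx S i == j) = (a <= i <= b)%N].
Proof.
move=> jS; have [i0 ij] := idx_surj jS.
have Pi0 : idx S i0 == j by rewrite ij.
have [a /eqP Pa amin] := arg_minnP (P := fun i : 'I_m.+1 => idx S i == j) (fun i : 'I_m.+1 => i : nat) Pi0.
have [b /eqP Pb bmax] := arg_maxnP (P := fun i : 'I_m.+1 => idx S i == j) (fun i : 'I_m.+1 => i : nat) Pi0.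
exists a, b; split => //; first by apply: bmax; rewrite Pa.
move=> i; apply/idP/andP => [ii|[ai ib]]; first by split; [exact: amin|exact: bmax].
by rewrite eqn_leq -{1}Pb -{1}Pa !idx_mono.
Qed.

Lemma block_setU1_lo S (s : 'I_m) (i : 'I_m.+1) : s \notin S ->
  (idx (s |: S)%SET i == idx S s) = (idx S i == idx S s) && (i <= s)%N.
Proof.
move=> sS; rewrite idx_setU1//; case: (ltnP s i) => si.
  by rewrite andbF; apply/negbTE; rewrite addn1 gtn_eqF// ltnS idx_mono// ltnW.
by rewrite addn0 andbT.
Qed.

Lemma block_setU1_hi S (s : 'I_m) (i : 'I_m.+1) : s \notin S ->
  (idx (s |: S)%SET i == (idx S s).+1) = (idx S i == idx S s) && (s < i)%N.
Proof.
move=> sS; rewrite idx_setU1//; case: (ltnP s i) => si.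
  by rewrite addn1 eqSS andbT.
by rewrite andbF addn0; apply/negbTE; rewrite ltn_eqF// ltnS idx_mono.
Qed.

Lemma block_setU1_before S (s : 'I_m) j : s \notin S -> (j < idx S s)%N ->
  block (s |: S)%SET j = block S j.
Proof.
move=> sS js; apply/setP => i; rewrite !inE idx_setU1//; case: (ltnP s i) => si.
  have := idx_mono S (ltnW si) => sSi.
  by rewrite addn1 [RHS]gtn_eqF ?(leq_trans js)// gtn_eqF// ltnS (leq_trans (ltnW js)).
by rewrite addn0.
Qed.

Lemma block_setU1_after S (s : 'I_m) j : s \notin S -> (idx S s < j)%N ->
  block (s |: S)%SET j.+1 = block S j.
Proof.
move=> sS js; apply/setP => i; rewrite !inE idx_setU1//; case: (ltnP s i) => si.
  by rewrite addn1 eqSS.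
have := idx_mono S si => sSi.
by rewrite addn0 [RHS]ltn_eqF ?(leq_ltn_trans sSi)// ltn_eqF// (leq_ltn_trans sSi)// ltnW.
Qed.

Variable theta : R.

Definition cut_weight S : R :=
  theta ^ ((#|S|.+1)%:Z - (m.+1)%:Z) * \prod_(j < #|S|.+1) (#|block S j|%:R)^-1.

(* The factor m' / (k (m' - k)) for a block of size m' split by s into blocks
   of sizes k and m' - k. *)
Definition split_coef S (s : 'I_m) : R :=
  #|block S (idx S s)|%:R / (#|block (s |: S)%SET (idx S s)|%:R *
    #|block (s |: S)%SET (idx S s).+1|%:R).

(** One more block gives the factor theta. In the product only the block [idx S s] changes: earlier
    blocks keep their number, and later ones have it raised by one. *)
Lemma cut_weight_setU1 S s : theta != 0 -> s \notin S ->
  cut_weight (s |: S)%SET = theta * split_coef S s * cut_weight S.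
Proof.
move=> t0 sS; rewrite /cut_weight cardsU1 sS add1n.
have -> : theta ^ ((#|S|.+2)%:Z - (m.+1)%:Z) = theta * theta ^ ((#|S|.+1)%:Z - (m.+1)%:Z).
  by rewrite -{2}(expr1z theta) -expfzDr//; congr (_ ^ _); lia.
pose g k : R := (#|block (s |: S)%SET k|%:R)^-1; pose h k : R := (#|block S k|%:R)^-1.
have jS : (idx S s <= #|S|)%N by rewrite -(idx_all S) idx_mono// ltnW.
(* This block contains the index s, so its size can be cancelled. *)
have hj : h (idx S s) != 0.
  rewrite invr_neq0// pnatr_eq0 -lt0n; apply/card_gt0P.
  by exists (widen_ord (leqnSn m) s); rewrite inE.
rewrite -(big_mkord predT g) -(big_mkord predT h).
rewrite (@big_cat_nat _ _ _ (idx S s) 0 #|S|.+2)//=; last exact: leq_trans jS (leq_trans (leqnSn _) (leqnSn _)).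
rewrite (@big_cat_nat _ _ _ (idx S s) 0 #|S|.+1)//=; last exact: leq_trans jS (leqnSn _).
rewrite (@big_ltn _ _ _ (idx S s) #|S|.+2); last exact: leq_trans jS (leqnSn _).
rewrite (@big_ltn _ _ _ (idx S s).+1 #|S|.+2)//.
rewrite (@big_ltn _ _ _ (idx S s) #|S|.+1)//.
rewrite big_add1/=.
rewrite (eq_big_nat _ _ (F2 := h)); last first.
  by move=> k /andP[_ kj]; rewrite /g block_setU1_before.
rewrite [X in g _.+1 * X](eq_big_nat _ _ (F2 := h)); last first.
  by move=> k /andP[jk _]; rewrite /g block_setU1_after.
rewrite /split_coef invfM -/(g (idx S s)) -/(g (idx S s).+1).
have -> : #|block S (idx S s)|%:R = (h (idx S s))^-1 by rewrite invrK.
by field; exact: hj.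
Qed.

End block_weights.

Section jumps.
Context {R : realType} (m : nat).
Implicit Types S : {set 'I_m}.
Variables (u v : 'rV[R]_m.+1 -> R).

(** The derivatives belong to the finer face [s |: S], while x is meant to lie on the coarser face
    S, the wall on which the two halves of the split block meet. *)
Definition jump S (s : 'I_m) (x : 'rV[R]_m.+1) : R :=
  bd (s |: S)%SET (idx S s).+1 u x - bd (s |: S)%SET (idx S s) u x.

Definition wjump N S s : R := wint (fun z : 'rV[R]_N.+1 => jump S s (emb S z) * v (emb S z)).

(** The walls of the face S are the faces [S :\ s], one for each cut s in S: [sum_idx] passes from
    the wall number to the cut, and [emb_dup] identifies the wall points. *)
Lemma sum_flux S N : #|S| = N ->
  \sum_(j < N) wint (fun z : 'rV[R]_N =>
    (bd S j.+1 u (emb S (dup j z)) - bd S j u (emb S (dup j z))) * v (emb S (dup j z)))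
  = \sum_(s in S) wjump #|(S :\ s)%SET| (S :\ s)%SET s.
Proof.
case: N => [|N] SN.
  by rewrite big_ord0 big_pred0// => s; move/eqP: SN; rewrite cards_eq0 => /eqP ->; rewrite inE.
pose f k := wint (fun z : 'rV[R]_N.+1 => (bd S k.+1 u (emb S (dup (inord k) z))
  - bd S k u (emb S (dup (inord k) z))) * v (emb S (dup (inord k) z))).
transitivity (\sum_(j < N.+1) f j).
  by apply: eq_bigr => j _; rewrite /f inord_val.
rewrite -SN -sum_idx; apply: eq_bigr => s sS.
have sS' : s \notin (S :\ s)%SET by rewrite !inE eqxx.
have SE : (s |: (S :\ s))%SET = S by rewrite finset.setD1K.
have cS : #|(S :\ s)%SET| = N by move: SN; rewrite (cardsD1 s S) sS add1n => -[].
have iE : idx S s = idx (S :\ s)%SET s by rewrite -{1}SE idx_setU1// ltnn addn0.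
rewrite cS /wjump /jump SE /f; apply: eq_wint => z _.
by have := emb_dup z sS' cS; rewrite SE -iE => ->.
Qed.

(** The convention sign 0 = 1 puts i = s in the lower half of the split block, so the signed sum is
    the lower half minus the upper half. *)
Lemma sum_sign_block S (a b : 'I_m.+1) (s : 'I_m) x : s \notin S ->
  (forall i : 'I_m.+1, (idx S i == idx S s) = (a <= i <= b)%N) ->
  \sum_(i < m.+1 | (a <= i <= b)%N) partial i u x * signp R (s%:Z - i%:Z)
  = - jump S s x.
Proof.
move=> sS ab; rewrite /jump opprB /bd.
rewrite (bigID (fun i : 'I_m.+1 => (i <= s)%N))/=; congr (_ + _).
  apply: eq_big => [i|i /andP[_ is_]]; first by rewrite block_setU1_lo// ab.
  by rewrite /signp subr_ge0 lez_nat is_ mulr1.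
rewrite -sumrN; apply: eq_big => [i|i /andP[_ is_]].
  by rewrite block_setU1_hi// ab ltnNge.
by rewrite /signp subr_ge0 lez_nat (negbTE is_) mulrN1.
Qed.

End jumps.

(** * The boundary condition on a block *)

Section laplacian_split.
Context {R : realType} (m : nat) (theta : R) (u : 'rV[R]_m.+1 -> R).
Implicit Types S : {set 'I_m}.
Hypothesis Du : D_theta theta u.

Lemma split_coefE S (s : 'I_m) (a b : 'I_m.+1) : s \notin S ->
  (a <= s)%N -> (s < b)%N ->
  (forall i : 'I_m.+1, (idx S i == idx S s) = (a <= i <= b)%N) ->
  split_coef S s = (b - a + 1)%:R / ((s - a + 1)%:R * (b - s)%:R) :> R.
Proof.
move=> sS as_ sb ab; have sm := ltn_ord s; have bm := ltn_ord b.
rewrite /split_coef.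
have -> : #|block S (idx S s)| = (b - a + 1)%N.
  rewrite -(_ : (b.+1 - a)%N = (b - a + 1)%N); last lia.
  by rewrite -(@card_itv m.+1)//; apply: eq_card => i; rewrite !inE ab.
have -> : #|block (s |: S)%SET (idx S s)| = (s - a + 1)%N.
  rewrite -(_ : (s.+1 - a)%N = (s - a + 1)%N); last lia.
  rewrite -(@card_itv m.+1)//; last exact: ltnW.
  by apply: eq_card => i; rewrite !inE block_setU1_lo// ab; apply/idP/idP; lia.
have -> : #|block (s |: S)%SET (idx S s).+1| = (b - s)%N.
  rewrite -(_ : (b.+1 - s.+1)%N = (b - s)%N); last lia.
  rewrite -(@card_itv m.+1)//.
  by apply: eq_card => i; rewrite !inE block_setU1_hi// ab; apply/idP/idP; lia.
by [].
Qed.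

(* The boundary condition defining D_theta, with its summation index k replaced
   by the cut s = a + k - 1 that it stands for. *)
Lemma off_diagonal S j x : (j <= #|S|)%N -> closed_weyl R m.+1 x ->
  (forall i k : 'I_m.+1, idx S i = idx S k -> x 0 i = x 0 k) ->
  \sum_(i < m.+1 | idx S i == j) \sum_(k < m.+1 | (idx S k == j) && (i != k))
    partial i (partial k u) x =
  \sum_(s in ~: S | idx S s == j) theta * split_coef S s * jump u S s x.
Proof.
move=> jS xW xS; have [a [b [ab aj bj ijE]]] := block_itv jS.
(* A position s can split block j when both s and s + 1 lie in it, which excludes s = b. *)
have sE (s : 'I_m) : (s \in ~: S)%SET && (idx S s == j) = (a <= s < b)%N.
  have /= e1 := ijE (widen_ord (leqnSn m) s); have /= e2 := ijE (lift ord0 s).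
  rewrite /bump leq0n add1n in e2.
  rewrite inE; apply/andP/andP => [[sS /eqP sj]|[as_ sb]].
    move: e1 e2; rewrite idxS (negbTE sS) add0n sj eqxx => /esym/andP[-> _].
    by move=> /esym/andP[].
  move: e1; rewrite as_ (ltnW sb) => /eqP sj; rewrite sj eqxx; split => //.
  by move: e2; rewrite sb leqW// idxS sj -[X in _ == X]add0n eqn_add2r; case: (s \in S).
have sab (s : 'I_m) : (a <= s < b)%N -> s \notin S /\
    forall i : 'I_m.+1, (idx S i == idx S s) = (a <= i <= b)%N.
  by rewrite -sE inE => /andP[sS /eqP ->].
rewrite (eq_bigl _ _ sE) (eq_bigl _ _ ijE).
rewrite (eq_bigr (fun i => \sum_(k < m.+1 | (a <= k <= b)%N && (i != k))
  partial i (partial k u) x)); last by move=> i _; apply: eq_bigl => k; rewrite ijE.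
(* A one-element block has neither off-diagonal pairs nor places to split, and [D_theta] speaks only
   of a < b. *)
have [ba|altb] := leqP b a.
  rewrite [RHS]big_pred0; last by move=> s; apply/negbTE; lia.
  apply: big1 => i iab; apply: big1 => k kab; exfalso.
  by move: kab; rewrite -val_eqE/=; lia.
have /(_ a b x altb xW)/= := Du.2.
rewrite (xS a b) ?aj ?bj// => /(_ erefl) D.
pose c k : R := (b - a + 1)%:R / (k%:R * (b - a + 1 - k)%:R).
have {}D : \sum_(i < m.+1 | (a <= i <= b)%N) \sum_(k < m.+1 | (a <= k <= b)%N && (i != k))
    partial i (partial k u) x = - theta * \sum_(i < m.+1 | (a <= i <= b)%N)
    partial i u x * \sum_(1 <= k < b - a + 1) c k * signp R (k%:Z - i%:Z + a%:Z - 1).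
  set X := \sum_(i < m.+1 | _) \sum_(k < _ | _) _; apply: (mulfI (x := 2^-1)) => //.
  by rewrite {}/X D !mulrA; congr (_ * _); field.
(* G collects the terms of one cut, whereas [D_theta] has the sum over i outside; the two sums are
   exchanged below. *)
pose G (s : nat) : R := - theta * c (s - a + 1)%N *
  \sum_(i < m.+1 | (a <= i <= b)%N) partial i u x * signp R (s%:Z - i%:Z).
transitivity (\sum_(a <= s < b) G s); last first.
  have bm : (b <= m)%N by rewrite -ltnS.
  rewrite (big_nat_widen _ _ _ _ _ bm) (big_nat_widenl _ _ _ _ _ (leq0n a)) big_mkord.
  apply: eq_big => [s|s]; first by rewrite /= andbC.
  move=> /andP[/= sb as_]; have /sab[sS sI] : (a <= s < b)%N by rewrite as_.
  rewrite /G (sum_sign_block u x sS sI) mulrN !mulNr opprK; congr (_ * _ * _).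
  rewrite (split_coefE sS as_ sb sI) /c; congr (_ / (_ * _%:R)); lia.
have -> : \sum_(a <= s < b) G s = \sum_(1 <= k < b - a + 1) G (k.-1 + a)%N.
  by rewrite addn1 big_add1/= -{1}[nat_of_ord a]add0n big_addn.
rewrite D mulr_sumr; under eq_bigr do rewrite mulr_sumr mulr_sumr.
rewrite exchange_big/= big_nat_cond [RHS]big_nat_cond; apply: eq_bigr => k.
rewrite andbT => /andP[k0 kb].
rewrite /G (_ : (k.-1 + a - a + 1)%N = k); last lia.
rewrite mulr_sumr; apply: eq_bigr => i _.
rewrite (_ : (k%:Z - i%:Z + a%:Z - 1) = ((k.-1 + a)%N%:Z - i%:Z)); last lia.
by ring.
Qed.

End laplacian_split.

(** * The identity for compactly supported test functions *)

Section compact_support.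
Context {R : realType} (m : nat) (theta : R) (u : 'rV[R]_m.+1 -> R).
Implicit Types S : {set 'I_m}.
Hypotheses (theta0 : theta != 0) (Du : D_theta theta u).

Lemma sum_by_idx (I : finType) (P : pred I) (k : I -> nat) (f : I -> R) N :
  (forall i, P i -> (k i <= N)%N) ->
  \sum_(j < N.+1) \sum_(i | P i && (k i == j)) f i = \sum_(i | P i) f i.
Proof.
move=> kN; rewrite [RHS](partition_big (fun i => inord (k i) : 'I_N.+1) predT)//=.
apply: eq_bigr => j _; apply: eq_bigl => i; case: (boolP (P i)) => //= Pi.
by rewrite -val_eqE/= inordK// ltnS kN.
Qed.

Lemma laplacian_faces S N (y : 'rV[R]_N.+1) : #|S| = N -> closed_weyl R N.+1 y ->
  laplacian u (emb S y) = \sum_(j < N.+1) bd2 S j u (emb S y)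
    - \sum_(s in ~: S) theta * split_coef S s * jump u S s (emb S y).
Proof.
move=> SN yW; set x := emb S y.
have xW : closed_weyl R m.+1 x by exact: emb_closed_weyl.
have xS (i k : 'I_m.+1) : idx S i = idx S k -> x 0 i = x 0 k by move=> ik; rewrite !mxE ik.
rewrite -(@sum_by_idx _ (fun s => s \in ~: S)%SET (idx S) _ N); last first.
  by move=> s _; rewrite -SN -(idx_all S) idx_mono// ltnW.
rewrite -sumrB /laplacian -(@sum_by_idx _ predT (fun i : 'I_m.+1 => idx S i) _ N); last first.
  by move=> i _; rewrite -SN idx_le.
apply: eq_bigr => j _; apply/esym/eqP; rewrite subr_eq; apply/eqP.
rewrite -(off_diagonal Du)//; last by rewrite SN -ltnS.
(* The exchange gives both sides the same order of differentiation; then the diagonal term i = k is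
   split off. *)
rewrite -big_split/= /bd2 /bd exchange_big/=; apply: eq_bigr => i ij.
rewrite (bigD1 i)//=; congr (_ + _); apply: eq_bigl => k.
by rewrite [k == i]eq_sym.
Qed.

Section fixed_test.
Variables (v : 'rV[R]_m.+1 -> R) (U : set 'rV[R]_m.+1) (M : R).
Hypotheses (oU : open U) (subU : closed_weyl R m.+1 `<=` U).
Hypotheses (u2 : C_on 2 U u) (v1 : C_on 1 U v).
Hypothesis (v0 : forall x, M < `|x| -> v x = 0).

Lemma wint_laplacian S N : #|S| = N ->
  wint (fun y : 'rV[R]_N.+1 => laplacian u (emb S y) * v (emb S y)) =
  \sum_(s in S) wjump u v #|(S :\ s)%SET| (S :\ s)%SET s
  - \sum_(s in ~: S) theta * split_coef S s * wjump u v N S s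
  - wint (fun y : 'rV[R]_N.+1 => \sum_(j < N.+1) bd S j u (emb S y) * bd S j v (emb S y)).
Proof.
move=> SN.
pose A (j : 'I_N.+1) (y : 'rV[R]_N.+1) := bd2 S j u (emb S y) * v (emb S y).
pose J s (y : 'rV[R]_N.+1) := theta * split_coef S s * (jump u S s (emb S y) * v (emb S y)).
have cv : wcont (fun y : 'rV[R]_N.+1 => v (emb S y)).
  by apply: (wcont_emb SN subU); exact: C_onS.
have iA j : wintegrable (A j).
  apply: (@integrable_bounded_support _ _ _ M) => [|y _ My].
    by apply: wcontM cv; exact: (wcont_bd2 SN subU u2).
  by rewrite /A (v_emb0 SN v0)// mulr0.
have ij s : wintegrable (fun y : 'rV[R]_N.+1 => jump u S s (emb S y) * v (emb S y)).
  apply: (@integrable_bounded_support _ _ _ M) => [|y _ My].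
    apply: wcontM cv; apply: wcontD; last apply: wcontN;
      by apply: (wcont_bd SN subU); exact: C_onS.
  by rewrite (v_emb0 SN v0)// mulr0.
have iJ s : wintegrable (J s) by exact: wintegrableZ.
rewrite -(sum_flux u v SN) -(wint_flux SN oU subU u2 v1 v0) addrAC addrK.
have [iAs _] := @wint_sum _ _ _ (index_enum 'I_N.+1) predT A (fun j _ => iA j).
have [iJs wJs] := @wint_sum _ _ _ (index_enum 'I_m) (fun s => s \in ~: S)%SET J (fun s _ => iJ s).
rewrite (eq_wint (g := fun y => \sum_(j < N.+1) A j y - \sum_(s in ~: S) J s y)); last first.
  move=> y /weyl_sub yW; rewrite (laplacian_faces SN yW) mulrBl !mulr_suml; congr (_ - _).
  by apply: eq_bigr => s _; rewrite /J mulrA.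
rewrite wintB// wJs; congr (_ - _); apply: eq_bigr => s _.
exact: wintZ.
Qed.

(* The jump of u across s occurs both as a flux out of the face s |: S and in the
   boundary condition on the face S; cut_weight_setU1 makes the two cancel. *)
Lemma compact_identity :
  \sum_(S : {set 'I_m}) cut_weight theta S *
    wint (fun y : 'rV[R]_(#|S|).+1 => laplacian u (emb S y) * v (emb S y)) =
  - \sum_(S : {set 'I_m}) cut_weight theta S *
    wint (fun y : 'rV[R]_(#|S|).+1 => \sum_(j < #|S|.+1) bd S j u (emb S y) * bd S j v (emb S y)).
Proof.
rewrite -sumrN; apply/eqP; rewrite -subr_eq0 -sumrB; apply/eqP.
under eq_bigr do rewrite wint_laplacian// -mulrN -mulrBr opprK subrK.
under eq_bigr do rewrite mulrBr; rewrite sumrB; apply/eqP; rewrite subr_eq0; apply/eqP.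
transitivity (\sum_(S : {set 'I_m}) \sum_(s in S)
    cut_weight theta S * wjump u v #|(S :\ s)%SET| (S :\ s)%SET s).
  by apply: eq_bigr => S _; rewrite mulr_sumr.
transitivity (\sum_(S : {set 'I_m}) \sum_(s in ~: S)
    cut_weight theta (s |: S)%SET * wjump u v #|S| S s); last first.
  apply: eq_bigr => S _; rewrite mulr_sumr; apply: eq_bigr => s; rewrite inE => sS.
  by rewrite cut_weight_setU1//; ring.
rewrite [LHS](exchange_big_dep predT)//= [RHS](exchange_big_dep predT)//=.
apply: eq_bigr => s _.
(* For a fixed s, adding s is a bijection from the sets avoiding s to the sets containing it. *)
rewrite (reindex_onto (fun S => s |: S)%SET (fun S => S :\ s)%SET)/=; last first.
  by move=> S sS; rewrite finset.setD1K.
apply: eq_big => [S|S /andP[_ /eqP ->]//].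
rewrite !inE eqxx/=; apply/eqP/idP => [<-|sS]; first by rewrite !inE eqxx.
by rewrite finset.setU1K.
Qed.

End fixed_test.
End compact_support.

(** * Truncation of the test function *)

Section cutoff.
Context {R : realType}.

Lemma is_derive_coord n (x v : 'rV[R]_n) i : is_derive x v (fun x : 'rV[R]_n => x 0 i) (v 0 i).
Proof.
have dv : derivable (fun x : 'rV[R]_n => x 0 i) x v.
  apply: diff_derivable; exact: differentiable_coord.
have did : derivable (@id 'rV[R]_n) x v by exact: derivable_id.
split => //; have := derive_mx did; rewrite derive_id => /matrixP/(_ 0 i).
by rewrite mxE => ->.
Qed.

(** A quadratic remainder bound treats the square of max(0, t) uniformly, including its kink at
    0. *)
Lemma is_derive_quadratic (f : R -> R) (x l : R) :
  (forall h, `|f (h + x) - f x - h * l| <= h ^+ 2) -> is_derive x 1 f l.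
Proof.
move=> fl.
have H : (fun h : R => h^-1 *: ((f \o shift x) (h *: 1) - f x)) @ 0^' --> l.
  apply/cvgrPdist_le => e e0; near=> h.
  have h0 : h != 0 by near: h; exact: nbhs_dnbhs_neq.
  rewrite /= /shift/= [h *: 1]mulr1.
  have -> : l - h^-1 *: (f (h + x) - f x) = - (h^-1 * (f (h + x) - f x - h * l)).
    have -> : h^-1 *: (f (h + x) - f x) = h^-1 * (f (h + x) - f x) :> R by [].
    by field.
  rewrite normrN normrM normfV ler_pdivrMl ?normr_gt0// (le_trans (fl h))//.
  rewrite -real_normK ?num_real// expr2 ler_wpM2l//; near: h.
  by apply: dnbhs0_le.
by split; [apply: cvgP H|exact: cvg_lim H].
Unshelve. all: by end_near. Qed.

Lemma is_derive_max_sqr (t : R) :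
  is_derive t 1 (fun t : R => Num.max 0 t ^+ 2) (2 * Num.max 0 t).
Proof.
apply: is_derive_quadratic => h; rewrite ler_norml.
have h2 := sqr_ge0 h; have th2 := sqr_ge0 (h + t); have t2 := sqr_ge0 t.
have [ht|ht] := leP 0 (h + t); have [t0|t0] := leP 0 t.
- by apply/andP; split; lra.
- have : (h + t) ^+ 2 <= h ^+ 2 by rewrite lerXn2r ?nnegrE; lra.
  by move=> ?; apply/andP; split; lra.
- have : 0 <= t * (- (h + t)) by rewrite mulr_ge0//; lra.
  by move=> ?; apply/andP; split; lra.
- by apply/andP; split; lra.
Qed.

Lemma is_derive_comp (V : normedModType R) (r : R -> R) (p : V -> R) (x v : V) (l d : R) :
  is_derive (p x) 1 r l -> differentiable p x -> is_derive x v p d ->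
  is_derive x v (r \o p) (l * d).
Proof.
move=> [dr rl] dp [_ pd]; have dr' : differentiable r (p x) by exact/derivable1_diffP.
have drp : differentiable (r \o p) x by exact: differentiable_comp.
split; first exact: diff_derivable.
rewrite deriveE// diff_comp//=; have -> : 'd p x v = d by rewrite -deriveE.
by rewrite diff1E// derive1E rl mulrC.
Qed.

Lemma continuous_max0 : continuous (fun t : R => Num.max 0 t).
Proof.
rewrite (_ : (fun t => _) = (fun t : R => 2^-1 * (t + `|t|))).
  move=> t; apply: cvgM; first exact: cvg_cst.
  by apply: cvgD; [exact: cvg_id|exact: (@norm_continuous _ R^o)].
by apply/funext => t; have [t0|t0] := leP 0 t; [rewrite ger0_norm|rewrite ltr0_norm]; lra.
Qed.

Variables (n k : nat).

(* A C^1 bump supported in the Euclidean ball of radius k + 1. *)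
Definition cutoff (x : 'rV[R]_n) : R := Num.max 0 (1 - dot x x / k.+1%:R ^+ 2) ^+ 2.

Definition dcutoff (i : 'I_n) (x : 'rV[R]_n) : R :=
  - 4 * x 0 i / k.+1%:R ^+ 2 * Num.max 0 (1 - dot x x / k.+1%:R ^+ 2).

Let p (x : 'rV[R]_n) : R := 1 - dot x x / k.+1%:R ^+ 2.

Let dp (x : 'rV[R]_n) i : is_derive x (delta_mx 0 i) p (- (2 * x 0 i) / k.+1%:R ^+ 2).
Proof.
have d1 : is_derive x (delta_mx 0 i) (fun x => \sum_j x 0 j * x 0 j) (2 * x 0 i).
  rewrite (_ : 2 * x 0 i = \sum_j (x 0 j *: (delta_mx 0 i : 'rV[R]_n) 0 j + x 0 j *: (delta_mx 0 i : 'rV[R]_n) 0 j)).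
    apply: is_derive_bigsum => j _; apply: is_deriveM; exact: is_derive_coord.
  rewrite (bigD1 i)//= big1 ?addr0 => [|j ji].
    by rewrite !mxE !eqxx/= -[_ *: _]/(_ * _) !mulr1 mulr_natl mulr2n.
  by rewrite !mxE (negbTE ji) andbF !scaler0 addr0.
have d2 := is_deriveB (is_derive_cst (1 : R) x (delta_mx 0 i)) (is_deriveZ (k.+1%:R ^- 2) d1).
rewrite (_ : p = (cst 1 - (k.+1%:R ^- 2 \*: (fun x : 'rV[R]_n => \sum_j x 0 j * x 0 j)))).
  suff -> : - (2 * x 0 i) / k.+1%:R ^+ 2 = 0 - k.+1%:R ^- 2 *: (2 * x 0 i) by exact: d2.
  by rewrite sub0r mulNr; congr (- _); exact: mulrC.
by apply/funext => y; rewrite /p mulrC.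
Qed.

Let diff_p x : differentiable p x.
Proof.
have d1 : differentiable (fun x : 'rV[R]_n => dot x x) x.
  rewrite (_ : (fun x => _) = \sum_(j < n) (fun x : 'rV[R]_n => x 0 j * x 0 j)).
    apply: differentiable_sum => j; apply: differentiableM; exact: differentiable_coord.
  by apply/funext => y; rewrite fct_sumE.
rewrite (_ : p = (cst 1 - (k.+1%:R ^- 2 \*: (fun x : 'rV[R]_n => dot x x)))).
  apply: differentiableB; first exact: differentiable_cst.
  exact: differentiableZ.
by apply/funext => y; rewrite /p mulrC.
Qed.

Lemma is_derive_cutoff x i : is_derive x (delta_mx 0 i) cutoff (dcutoff i x).
Proof.
have := is_derive_comp (is_derive_max_sqr (p x)) (diff_p x) (dp x i).
by rewrite (_ : _ * _ = dcutoff i x)// /dcutoff /p; ring.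
Qed.

Lemma partial_cutoff i : partial i cutoff = dcutoff i.
Proof. by apply/funext => x; have [_ <-] := is_derive_cutoff x i. Qed.

Let cont_p : continuous p.
Proof. by move=> x; exact: differentiable_continuous. Qed.

Let cont_max (g : 'rV[R]_n -> R) : continuous g -> continuous (fun x => Num.max 0 (g x)).
Proof.
move=> cg x; apply: (@continuous_comp _ _ _ g (fun t => Num.max 0 t)); first exact: cg.
exact: continuous_max0.
Qed.

Lemma C1_cutoff U : C_on 1 U cutoff.
Proof.
have cm := cont_max cont_p.
split=> [x _|i].
  rewrite (_ : cutoff = fun x => Num.max 0 (p x) * Num.max 0 (p x)).
    by apply: continuousM; exact: cm.
  by apply/funext => y; rewrite /cutoff expr2.
split=> [x _|]; first by have [] := is_derive_cutoff x i.
split => // x _; rewrite partial_cutoff.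
apply: continuousM; last exact: cm.
rewrite (_ : (fun x => _) = (fun x : 'rV[R]_n => (- 4 / k.+1%:R ^+ 2) * x 0 i)).
  by apply: continuousM; [exact: cst_continuous|exact: coord_continuous].
by apply/funext => y; rewrite mulrAC.
Qed.

Let K0 : 0 < k.+1%:R :> R. Proof. by []. Qed.

Let K20 : 0 < k.+1%:R ^+ 2 :> R. Proof. exact: exprn_gt0. Qed.

Let enorm_sqr (x : 'rV[R]_n) : enorm x ^+ 2 = dot x x.
Proof. by rewrite sqr_sqrtr// dot_ge0. Qed.

Let p_le0 x : k.+1%:R <= enorm x -> p x <= 0.
Proof.
move=> kx; rewrite /p subr_le0 ler_pdivlMr// mul1r -enorm_sqr.
by rewrite lerXn2r ?nnegrE ?enorm_ge0.
Qed.

Lemma cutoff_out x : k.+1%:R < `|x| -> cutoff x = 0.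
Proof.
move=> kx; rewrite /cutoff (max_idPl _) ?expr0n//; apply: p_le0.
rewrite (le_trans (ltW kx))//; apply: mx_norm_leP; first exact: enorm_ge0.
exact: coord_le_enorm.
Qed.

Lemma cutoff_ge0 x : 0 <= cutoff x. Proof. exact: sqr_ge0. Qed.

Let max01 x : 0 <= Num.max 0 (p x) <= 1.
Proof.
by rewrite le_max lexx ge_max ler01/= /p lerBlDr lerDl divr_ge0 ?dot_ge0.
Qed.

Lemma cutoff_le1 x : cutoff x <= 1.
Proof. by have /andP[? ?] := max01 x; rewrite exprn_ile1. Qed.

(** Inside the ball of radius k + 1, |x_i| absorbs one of the two factors k + 1 in the denominator;
    outside it the derivative is 0. The 4 combines the derivatives of the outer and the inner
    square. *)
Lemma dcutoff_le i x : `|dcutoff i x| <= 4 / k.+1%:R.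
Proof.
rewrite /dcutoff; have [kx|xk] := leP k.+1%:R (enorm x).
  by rewrite (max_idPl (p_le0 kx)) mulr0 normr0 divr_ge0.
have /andP[m0 m1] := max01 x.
rewrite normrM [X in _ * X]ger0_norm// -[leRHS]mulr1 ler_pM//.
rewrite !normrM normrN normr_nat normfV (ger0_norm (ltW K20)) -mulrA ler_wpM2l//.
rewrite ler_pdivrMr// expr2 mulrA mulVf ?gt_eqF// mul1r.
exact: le_trans (coord_le_enorm x i) (ltW xk).
Qed.

End cutoff.

Lemma cvg_cutoff {R : realType} n (x : 'rV[R]_n) : cutoff k x @[k --> \oo] --> (1 : R).
Proof.
have c : (1 - dot x x / k.+1%:R ^+ 2) @[k --> \oo] --> (1 - dot x x * (0 * 0) : R).
  apply: cvgB; first exact: cvg_cst.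
  apply: cvgM; first exact: cvg_cst.
  rewrite (_ : (fun k => _) = (fun k => (k.+1%:R^-1 : R) * k.+1%:R^-1)).
    by apply: cvgM; exact: cvg_harmonic.
  by apply/funext => k; rewrite -exprVn expr2.
rewrite (_ : 1 = Num.max 0 (1 - dot x x * (0 * 0)) ^+ 2 :> R); last first.
  by rewrite !mulr0 subr0 (max_idPr ler01) expr1n.
rewrite (_ : (fun k => _) = (fun k => Num.max 0 (1 - dot x x / k.+1%:R ^+ 2) *
    Num.max 0 (1 - dot x x / k.+1%:R ^+ 2))) ?expr2//.
  by apply: cvgM; exact: (cvg_comp _ _ c (@continuous_max0 R _)).
Qed.

(** * Passage to the limit *)

Section limit.
Context {R : realType}.

Lemma wint_dominated n (f_ : nat -> 'rV[R]_n -> R) (f g : 'rV[R]_n -> R) :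
  (forall k, wintegrable (f_ k)) -> wintegrable f -> wintegrable g ->
  (forall y, weyl R n y -> f_ k y @[k --> \oo] --> f y) ->
  (forall k y, weyl R n y -> `|f_ k y| <= g y) ->
  wint (f_ k) @[k --> \oo] --> wint f.
Proof.
move=> if_ if_f ig fc fg; have mW := measurable_weyl R n.
have [] := @dominated_convergence _ _ _ (lebesgue_rV R n) _ mW
  (fun k => EFin \o f_ k) (EFin \o f) (EFin \o g).
- by move=> k; have /integrableP[] := if_ k.
- by have /integrableP[] := if_f.
- by apply: aeW => y yW; apply: cvg_EFin; [exact: nearW|exact: fc].
- exact: ig.
- by apply: aeW => y k yW; rewrite lee_fin fg.
move=> _ _ H; rewrite /wint /Rintegral; apply: fine_cvg.
by rewrite fineK; [exact: H|exact: (integrable_fin_num mW)].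
Qed.

Lemma measurable_wcont n (f : 'rV[R]_n -> R) : wcont f -> measurable_fun (weyl R n) f.
Proof.
by move=> cf; apply: measurable_fun_open; [exact: open_weyl|move=> y /weyl_sub/cf].
Qed.

Lemma wintegrable_le n (f g : 'rV[R]_n -> R) : measurable_fun (weyl R n) f ->
  (forall y, weyl R n y -> `|f y| <= `|g y|) -> wintegrable g -> wintegrable f.
Proof.
move=> mf fg; apply: le_integrable; first exact: measurable_weyl.
  exact/measurable_EFinP.
by move=> y yW; rewrite lee_fin fg.
Qed.

(** As |c| is at most 1, |f| itself dominates; this settles every term in which the cutoff is not
    differentiated. *)
Lemma wint_cutoff n (f : 'rV[R]_n -> R) (c : nat -> 'rV[R]_n -> R) :
  wintegrable f -> (forall k, wcont (c k)) ->
  (forall k y, `|c k y| <= 1) -> (forall y, c k y @[k --> \oo] --> (1 : R)) ->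
  (forall k, wintegrable (fun y => f y * c k y)) /\
  wint (fun y => f y * c k y) @[k --> \oo] --> wint f.
Proof.
move=> fi cc c1 cl.
have H k y : `|f y * c k y| <= `|f y| by rewrite normrM ler_piMr.
have I k : wintegrable (fun y => f y * c k y).
  apply: wintegrable_le (fi) => [|y _]; last exact: H.
  apply: measurable_funM; last exact: measurable_wcont.
  by have /integrableP[/measurable_EFinP] := fi.
split => //; apply: (@wint_dominated _ _ _ (fun y => `|f y|)) => //.
  by have := integrable_abse fi.
by move=> y _; rewrite -[X in _ --> X]mulr1; apply: cvgM; [exact: cvg_cst|exact: cl].
Qed.

Lemma cvg_bigsum (I : Type) (r : seq I) (a : I -> nat -> R) (b : I -> R) :
  (forall i, a i k @[k --> \oo] --> b i) ->
  \sum_(i <- r) a i k @[k --> \oo] --> \sum_(i <- r) b i.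
Proof.
move=> ab; elim: r => [|i r IH].
  by rewrite big_nil; under eq_fun do rewrite big_nil; exact: cvg_cst.
by rewrite big_cons; under eq_fun do rewrite big_cons; exact: cvgD.
Qed.

Lemma near_continuous n (f g : 'rV[R]_n -> R) x :
  (\forall y \near x, f y = g y) -> {for x, continuous f} -> {for x, continuous g}.
Proof.
move=> fg cf A; rewrite -(nbhs_singleton fg) => /cf cfA.
by apply: filterS (filterI fg cfA) => y [/= <-].
Qed.

Lemma partialM n (f g : 'rV[R]_n -> R) x i :
  derivable f x (delta_mx 0 i) -> derivable g x (delta_mx 0 i) ->
  partial i (fun x => f x * g x) x = f x * partial i g x + g x * partial i f x.
Proof. exact: deriveM. Qed.

Lemma C1_mul n (U : set 'rV[R]_n) (f g : 'rV[R]_n -> R) : open U ->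
  C_on 1 U f -> C_on 1 U g -> C_on 1 U (fun x => f x * g x).
Proof.
move=> oU [cf f1] [cg g1]; split=> [x Ux|i].
  by apply: continuousM; [exact: cf|exact: cg].
have [df [cdf _]] := f1 i; have [dg [cdg _]] := g1 i.
split=> [x Ux|]; first by apply: derivableM; [exact: df|exact: dg].
split=> // x Ux.
(* The Leibniz formula is known only on the open set U, hence near x, which suffices for continuity
   at x. *)
apply: (@near_continuous _ (fun x => f x * partial i g x + g x * partial i f x)).
  have : nbhs x U by exact: open_nbhs_nbhs.
  by apply: filterS => y Uy; rewrite partialM//; [exact: df|exact: dg].
by apply: continuousD; apply: continuousM; [exact: cf|exact: cdg|exact: cg|exact: cdf].
Qed.

Lemma wcont_exp_enorm n (C c : R) : wcont (fun y : 'rV[R]_n => C * expR (- c * enorm y)).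
Proof.
have cd : wcont (fun y : 'rV[R]_n => dot y y).
  by apply: wcont_sum => i _; apply: wcontM => y _; exact: coord_continuous.
move=> y yW; apply: continuousM; first exact: cst_continuous.
apply: (@continuous_comp _ _ _ (fun y : 'rV[R]_n => - c * enorm y) expR).
  apply: continuousM; first exact: cst_continuous.
  apply: (@continuous_comp _ _ _ (fun y : 'rV[R]_n => dot y y) Num.sqrt); first exact: cd.
  exact: sqrt_continuous.
exact: continuous_expR.
Qed.

Variables (m : nat) (theta : R) (u v : 'rV[R]_m.+1 -> R).
Implicit Types S : {set 'I_m}.

Definition dirichlet S N (f g : 'rV[R]_m.+1 -> R) (y : 'rV[R]_N.+1) : R :=
  \sum_(j < N.+1) bd S j f (emb S y) * bd S j g (emb S y).

Hypotheses (theta0 : theta != 0) (Du : D_theta theta u) (v1 : C1_b v).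
Variables (a c : R).
Hypotheses (a0 : 0 < a) (c0 : 0 < c).
Hypothesis gradu : forall x, closed_weyl R m.+1 x -> enorm (grad u x) <= a * expR (- c * enorm x).
Hypothesis int_lap : forall S,
  wintegrable (fun y : 'rV[R]_(#|S|).+1 => laplacian u (emb S y) * v (emb S y)).
Hypothesis int_dir : forall S, wintegrable (@dirichlet S #|S| u v).

Let partial_u_le x i : closed_weyl R m.+1 x -> `|partial i u x| <= a * expR (- c * enorm x).
Proof.
move=> xW; apply: le_trans (gradu xW).
by have := coord_le_enorm (grad u x) i; rewrite mxE.
Qed.

Let vk k x : R := v x * cutoff k x.

Lemma identity_limit :
  \sum_(S : {set 'I_m}) cut_weight theta S *
    wint (fun y : 'rV[R]_(#|S|).+1 => laplacian u (emb S y) * v (emb S y)) =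
  - \sum_(S : {set 'I_m}) cut_weight theta S * wint (@dirichlet S #|S| u v).
Proof.
have [[Uu [oUu subUu u2]] _ _ _] := Du.1.
have [[Uv [oUv subUv v1']] [Mv Mv_bound]] := v1.
pose U := Uu `&` Uv.
have oU : open U by exact: openI.
have subU : closed_weyl R m.+1 `<=` U by move=> x xW; split; [exact: subUu|exact: subUv].
have {}u2 : C_on 2 U u by apply: C_on_sub u2 => x [].
have {}v1' : C_on 1 U v by apply: C_on_sub v1' => x [].
have vk1 k : C_on 1 U (vk k) by apply: C1_mul => //; exact: C1_cutoff.
have bd_vk S j k x : U x -> bd S j (vk k) x =
    v x * bd S j (cutoff k) x + cutoff k x * bd S j v x.
  move=> Ux; rewrite /bd !mulr_sumr -big_split/=; apply: eq_bigr => i _.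
  apply: partialM; first by case: v1' => _ /(_ i)[d _]; exact: d.
  by have [] := is_derive_cutoff k x i.
have vk0 k x : k.+1%:R < `|x| -> vk k x = 0.
  by move=> kx; rewrite /vk cutoff_out// mulr0.
have id_k k := compact_identity theta0 Du oU subU u2 (vk1 k) (vk0 k).
have cc k S : wcont (fun y : 'rV[R]_(#|S|).+1 => cutoff k (emb S y)).
  apply: (wcont_emb erefl subU); apply: C_onS; exact: C1_cutoff.
have c1 S k (y : 'rV[R]_(#|S|).+1) : `|cutoff k (emb S y)| <= 1.
  by rewrite ger0_norm ?cutoff_ge0// cutoff_le1.
have lapS S : wint (fun y : 'rV[R]_(#|S|).+1 => laplacian u (emb S y) * vk k (emb S y)) @[k --> \oo]
    --> wint (fun y : 'rV[R]_(#|S|).+1 => laplacian u (emb S y) * v (emb S y)).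
  have [_] := wint_cutoff (int_lap S) (cc^~ S) (@c1 S) (fun y => cvg_cutoff (emb S y)).
  by under eq_fun do under [X in wint X]eq_fun do rewrite -mulrA.
have dirS S : wint (@dirichlet S #|S| u (vk k)) @[k --> \oo] --> wint (@dirichlet S #|S| u v).
  pose x (y : 'rV[R]_(#|S|).+1) := @emb R m S #|S| y.
  pose E k (y : 'rV[R]_(#|S|).+1) :=
    v (x y) * \sum_(j < #|S|.+1) bd S j u (x y) * bd S j (cutoff k) (x y).
  (* |Mv| bounds v, #|S| + 1 counts the blocks, each m + 1 bounds the size of a block, a comes from
     the gradient bound and 4 from [dcutoff_le]. *)
  pose C := `|Mv| * (#|S|.+1%:R * ((m.+1%:R * a) * (m.+1%:R * 4))).
  have C0 : 0 <= C.
    by rewrite /C mulr_ge0 ?normr_ge0// mulr_ge0// mulr_ge0// mulr_ge0// ltW.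
  have xW y : weyl R _ y -> closed_weyl R m.+1 (x y).
    by move=> /weyl_sub yW; exact: emb_closed_weyl.
  have dirE k y : weyl R _ y -> dirichlet S u (vk k) y = dirichlet S u v y * cutoff k (x y) + E k y.
    move=> /xW/subU Ux; rewrite /dirichlet /E mulr_sumr mulr_suml -big_split/=.
    by apply: eq_bigr => j _; rewrite bd_vk//; ring.
  have EC k y : weyl R _ y -> `|E k y| <= C * expR (- c * enorm y) / k.+1%:R.
    move=> yW; have [vM _] := Mv_bound _ (xW y yW).
    have bdu j : `|bd S j u (x y)| <= m.+1%:R * a * expR (- c * enorm y).
      rewrite (le_trans (ler_norm_sum _ _ _))//.
      apply: (@le_trans _ _ (\sum_(i < m.+1) a * expR (- c * enorm y))).
        rewrite big_mkcond; apply: ler_sum => i _; case: ifP => _; last first.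
          by rewrite mulr_ge0 ?expR_ge0// ltW.
        apply: le_trans (partial_u_le i (xW y yW)) _; rewrite ler_pM2l// ler_expR.
        by rewrite !mulNr lerN2 ler_pM2l//; apply: enorm_select_ge; exact: emb_surj.
      by rewrite sumr_const card_ord -[leLHS]mulr_natl mulrA.
    have bdc j : `|bd S j (cutoff k) (x y)| <= m.+1%:R * 4 / k.+1%:R.
      rewrite (le_trans (ler_norm_sum _ _ _))//.
      apply: (@le_trans _ _ (\sum_(i < m.+1) 4 / k.+1%:R)).
        rewrite big_mkcond; apply: ler_sum => i _; case: ifP => _; last exact: divr_ge0.
        by rewrite partial_cutoff dcutoff_le.
      by rewrite sumr_const card_ord -[leLHS]mulr_natl mulrA.
    rewrite /E normrM (_ : C * _ / _ = `|Mv| * \sum_(j < #|S|.+1)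
      (m.+1%:R * a * expR (- c * enorm y)) * (m.+1%:R * 4 / k.+1%:R)); last first.
      by rewrite sumr_const card_ord -[(_ * _) *+ _]mulr_natl /C; ring.
    rewrite ler_pM// ?(le_trans vM (ler_norm _))//.
    rewrite (le_trans (ler_norm_sum _ _ _))//; apply: ler_sum => j _.
    by rewrite normrM ler_pM.
  have cE k : wcont (E k).
    apply: wcontM; first by apply: (wcont_emb erefl subU); exact: C_onS.
    apply: wcont_sum => j _; apply: wcontM; apply: (wcont_bd erefl subU).
      exact: C_onS.
    exact: C1_cutoff.
  have EC' k y : weyl R _ y -> `|E k y| <= C * expR (- c * enorm y).
    move=> yW; apply: le_trans (EC k y yW) _; rewrite ler_pdivrMr// ler_peMr ?ler1n//.
    by rewrite mulr_ge0 ?expR_ge0.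
  have iE k : wintegrable (E k).
    apply: (integrable_le_exp c0 (measurable_weyl R _)); first exact: measurable_wcont.
    exact: EC'.
  have ig : wintegrable (fun y : 'rV[R]_(#|S|).+1 => C * expR (- c * enorm y)).
    apply: (integrable_le_exp (K := C) c0 (measurable_weyl R _)) => [|y _].
      apply: measurable_wcont; exact: wcont_exp_enorm.
    by rewrite ger0_norm// mulr_ge0 ?expR_ge0.
  (* The factor 1 / (k + 1) gives the pointwise limit; the dominating function drops it. *)
  have E0 : wint (E k) @[k --> \oo] --> @wint R (#|S|).+1 (fun=> 0).
    apply: (wint_dominated iE (@wintegrable0 _ _) ig) => [y yW|k y yW]; last exact: EC'.
    apply/norm_cvg0P.
    have h : (C * expR (- c * enorm y)) * k.+1%:R^-1 @[k --> \oo] --> (C * expR (- c * enorm y) * 0 : R).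
      by apply: cvgM; [exact: cvg_cst|exact: cvg_harmonic].
    rewrite mulr0 in h; apply: (squeeze_cvgr _ (@cvg_cst _ _ _ _ _) h).
    by apply: nearW => k; rewrite normr_ge0 EC.
  have [ix dx] := wint_cutoff (int_dir S) (cc^~ S) (@c1 S) (fun y => cvg_cutoff (emb S y)).
  rewrite -[X in _ --> X]addr0 -(@wint0 R (#|S|).+1).
  have Ek : (fun k => wint (@dirichlet S #|S| u (vk k))) =
      (fun k => wint (fun y : 'rV[R]_(#|S|).+1 => dirichlet S u v y * cutoff k (emb S y)) + wint (E k)).
    apply/funext => k; rewrite -wintD//; apply: eq_wint => y yW; exact: dirE.
  by rewrite Ek; apply: cvgD.
pose L k : R := \sum_(S : {set 'I_m}) cut_weight theta S *
  wint (fun y : 'rV[R]_(#|S|).+1 => laplacian u (emb S y) * vk k (emb S y)).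
pose Rk k : R := - \sum_(S : {set 'I_m}) cut_weight theta S * wint (@dirichlet S #|S| u (vk k)).
have LR : L = Rk by apply/funext => k; exact: id_k.
have cL : L k @[k --> \oo] --> \sum_(S : {set 'I_m}) cut_weight theta S *
    wint (fun y : 'rV[R]_(#|S|).+1 => laplacian u (emb S y) * v (emb S y)).
  by apply: cvg_bigsum => S; apply: cvgM; [exact: cvg_cst|exact: lapS].
have cR : Rk k @[k --> \oo] --> - \sum_(S : {set 'I_m})
    cut_weight theta S * wint (@dirichlet S #|S| u v).
  by apply: cvgN; apply: cvg_bigsum => S; apply: cvgM; [exact: cvg_cst|exact: dirS].
(* The truncated identity holds for every k, so both limits are limits of one sequence. *)
rewrite -LR in cR; rewrite -(cvg_lim _ cL)//; exact: cvg_lim cR.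
Qed.

End limit.

(** * Ordered partitions *)

Section partitions.
Variable m : nat.
Implicit Types (S : {set 'I_m}) (p : m.+1.-bseq {set 'I_m.+1}).

Lemma size_cut_partition S : (size (mkseq (block S) #|S|.+1) <= m.+1)%N.
Proof. by rewrite size_mkseq ltnS -[leqRHS]card_ord max_card. Qed.

Definition cut_partition S : m.+1.-bseq {set 'I_m.+1} := Bseq (size_cut_partition S).

Definition partition_cuts p : {set 'I_m} :=
  [set s : 'I_m | ~~ has (fun B : {set 'I_m.+1} =>
    (widen_ord (leqnSn m) s \in B) && (lift ord0 s \in B)) p]%SET.

Lemma nth_cut_partition S j : (j < #|S|.+1)%N -> nth finset.set0 (cut_partition S) j = block S j.
Proof. exact: nth_mkseq. Qed.

Lemma mem_cut_partition S B : B \in (cut_partition S : seq _) ->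
  exists2 j, (j < #|S|.+1)%N & B = block S j.
Proof. by move=> /mapP[j]; rewrite mem_iota add0n => /andP[_ jS] ->; exists j. Qed.

Lemma block_mem S j : (j < #|S|.+1)%N -> block S j \in (cut_partition S : seq _).
Proof. by move=> jS; apply: map_f; rewrite mem_iota. Qed.

Lemma cut_partition_ordered S : cut_partition S \in ordered_partitions m.+1.
Proof.
rewrite inE; apply/andP; split.
  apply/and3P; split.
  - apply/eqP/setP => i; rewrite !inE; apply/bigcupP; exists (block S (idx S i)).
      by rewrite inE block_mem// ltnS idx_le.
    by rewrite inE.
  - apply/finset.trivIsetP => A B; rewrite !inE => /mem_cut_partition[j _ ->] /mem_cut_partition[l _ ->] jl.
    rewrite -finset.setI_eq0; apply/eqP/setP => i; rewrite !inE; apply/negbTE.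
    by apply: contraNN jl => /andP[/eqP <- /eqP <-].
  - rewrite inE; apply/negP => /mem_cut_partition[j]; rewrite ltnS => /idx_surj[i ij] /setP/(_ i).
    by rewrite !inE ij eqxx.
apply/forallP => j; apply/forallP => l; apply/implyP => jl.
have jS : (j < #|S|.+1)%N by have := ltn_ord j; rewrite [X in (_ < X)%N]size_mkseq.
have lS : (l < #|S|.+1)%N by have := ltn_ord l; rewrite [X in (_ < X)%N]size_mkseq.
rewrite !nth_cut_partition//; apply/forall_inP => a; rewrite inE => /eqP aj.
apply/forall_inP => b; rewrite inE => /eqP bl; rewrite ltnNge; apply/negP => /(idx_mono S).
by rewrite aj bl leqNgt jl.
Qed.

Lemma cut_partitionK S : partition_cuts (cut_partition S) = S.
Proof.
apply/setP => s; rewrite inE; have := idxS S s; case: (boolP (s \in S)) => sS iS.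
  apply/hasPn => B /mem_cut_partition[j _ ->]; rewrite !inE/= /bump leq0n add1n iS add1n.
  by apply/negP => /andP[/eqP -> /eqP]/eqP; rewrite gtn_eqF.
apply/negbTE; rewrite negbK; apply/hasP; exists (block S (idx S s)).
  by rewrite block_mem// ltnS -(idx_all S) idx_mono// ltnW.
by rewrite !inE/= /bump leq0n add1n iS add0n eqxx.
Qed.

Section ordered.
Variable p : m.+1.-bseq {set 'I_m.+1}.
Hypothesis p_op : p \in ordered_partitions m.+1.

Let blk i : exists2 j, (j < size p)%N & i \in nth finset.set0 p j.
Proof.
move: p_op; rewrite inE => /andP[/and3P[/eqP pT _ _] _].
have : i \in finset.cover [set B in p]%SET by rewrite pT inE.
case/bigcupP => B; rewrite inE => Bp iB.
by exists (index B p); rewrite ?index_mem// nth_index.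
Qed.

Let blk_lt j l a b : (j < l)%N -> (l < size p)%N ->
  a \in nth finset.set0 p j -> b \in nth finset.set0 p l -> (a < b)%N.
Proof.
move=> jl lp; move: p_op; rewrite inE => /andP[_ /forallP/(_ (Ordinal (ltn_trans jl lp)))].
move=> /forallP/(_ (Ordinal lp))/implyP/(_ jl).
by move=> /forall_inP/[apply]/forall_inP/[apply].
Qed.

Let blk_nonempty j : (j < size p)%N -> exists i, i \in nth finset.set0 p j.
Proof.
move=> jp; move: p_op; rewrite inE => /andP[/and3P[_ _ p0] _]; apply/set0Pn.
by apply: contraNneq p0 => <-; rewrite inE mem_nth.
Qed.

Let blk_uniq j l a : (j < size p)%N -> (l < size p)%N ->
  a \in nth finset.set0 p j -> a \in nth finset.set0 p l -> j = l.
Proof.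
move=> jp lp aj al; case: (ltngtP j l) => // jl.
  by have := blk_lt jl lp aj al; rewrite ltnn.
by have := blk_lt jl jp al aj; rewrite ltnn.
Qed.

Let S := partition_cuts p.

(** Induction on k. If k and k + 1 share a block, k is not a cut and the number stays. Otherwise the
    block of k + 1 is the next one: a lower number contradicts the order, and a higher one leaves a
    nonempty block strictly between k and k + 1. *)
Let in_blk k (km : (k < m.+1)%N) : Ordinal km \in nth finset.set0 p (idx S k).
Proof.
elim: k km => [|k IH] km.
  have [[|j] jp ij] := blk (Ordinal km); first by rewrite idx0.
  have [a a0] := blk_nonempty (ltn_trans (ltn0Sn j) jp).
  by have := blk_lt (ltn0Sn j) jp a0 ij.
have km' : (k < m)%N by [].
have := idxS S (Ordinal km') => /= ->.
have kI := IH (ltnW km); set a := Ordinal _ in kI; set b := Ordinal km.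
have [l lp bl] := blk b.
have kp : (idx S k < size p)%N.
  by rewrite ltnNge; apply/negP => pk; move: kI; rewrite nth_default// inE.
have aE : widen_ord (leqnSn m) (Ordinal km') = a by apply: val_inj.
have bE : lift ord0 (Ordinal km') = b by apply: val_inj.
rewrite /S inE aE bE; case: hasP => [[B Bp /andP[aB bB]]|nB] /=.
  rewrite (_ : nth _ _ _ = B)//; move: aB bB Bp => /[swap] _ /[swap] /(nthP finset.set0)[i ip <-] ai.
  by rewrite add0n (blk_uniq kp ip kI ai).
rewrite add1n; suff <- : l = (idx S k).+1 by [].
case: (ltngtP l (idx S k).+1) => //.
  rewrite ltnS leq_eqVlt => /predU1P[lk|lk].
    exfalso; apply: nB; exists (nth finset.set0 p l); first exact: mem_nth.
    by rewrite bl lk kI.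
  by have := blk_lt lk kp bl kI => /=; rewrite ltnNge leqnSn.
move=> kl; have [c ck] := blk_nonempty (ltn_trans kl lp).
have := blk_lt (ltnSn _) (ltn_trans kl lp) kI ck.
by have := blk_lt kl lp ck bl => /=; rewrite ltnS => h1 h2; move: (leq_trans h2 h1); rewrite ltnn.
Qed.

(** The last index m lies in block #|S|; one more block would need an element above m. *)
Let size_p : size p = #|S|.+1.
Proof.
have := in_blk (ltnSn m); rewrite idx_all => mI.
have Sp : (#|S| < size p)%N.
  by rewrite ltnNge; apply/negP => pk; move: mI; rewrite nth_default// inE.
apply/eqP; rewrite eqn_leq Sp andbT leqNgt; apply/negP => Sp'.
have [c cS] := blk_nonempty Sp'.
by have := blk_lt (ltnSn _) Sp' mI cS; rewrite ltnNge -ltnS ltn_ord.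
Qed.

Lemma partition_cutsK : cut_partition (partition_cuts p) = p.
Proof.
apply: val_inj => /=; apply: (@eq_from_nth _ finset.set0); first by rewrite size_mkseq size_p.
move=> j; rewrite size_mkseq => jS; rewrite nth_mkseq//; apply/setP => i.
have ip := in_blk (ltn_ord i).
rewrite (_ : Ordinal (ltn_ord i) = i) in ip; last exact: val_inj.
have iS : (idx S i < size p)%N by rewrite size_p ltnS idx_le.
rewrite inE; apply/eqP/idP => [<-//|ij].
by apply: (blk_uniq iS _ ip ij); rewrite size_p.
Qed.

End ordered.

Lemma sum_ordered_partitions (V : nmodType) (F : m.+1.-bseq {set 'I_m.+1} -> V) :
  \sum_(p in ordered_partitions m.+1) F p = \sum_(S : {set 'I_m}) F (cut_partition S).
Proof.
rewrite (reindex_onto cut_partition partition_cuts); last exact: partition_cutsK.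
by apply: eq_bigl => S; rewrite cut_partition_ordered cut_partitionK eqxx.
Qed.

Lemma weight_cut_partition (R : realType) (theta : R) S :
  weight theta (cut_partition S) = cut_weight theta S.
Proof.
rewrite /weight /cut_weight (size_mkseq _ _ : size (cut_partition S) = _); congr (_ * _).
rewrite -(big_mkord predT (fun j => (#|block S j|%:R : R)^-1)) /index_iota subn0.
by rewrite /cut_partition /mkseq big_map.
Qed.

End partitions.

(** * Integrals against [m_theta], face by face *)

Section faces_integral.
Context {R : realType} (n : nat).
Local Open Scope ereal_scope.

Lemma measurable_closed_weyl : measurable (closed_weyl R n).
Proof.
rewrite -[closed_weyl R n]setCK; apply: measurableC; apply: open_measurable_mx.
exact/closed_openC/closed_closed_weyl.
Qed.

Lemma ge0_integral_mrestr d (T : measurableType d) (mu : {measure set T -> \bar R})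
    (W D : set T) (mW : measurable W) (g : T -> \bar R) :
  measurable D -> W `<=` D -> measurable_fun D g -> (forall x, D x -> 0 <= g x) ->
  \int[mrestr mu mW]_(x in D) g x = \int[mu]_(x in W) g x.
Proof.
move=> mD WD mg g0.
have N0 : mrestr mu mW (~` W) = 0 by rewrite /mrestr setICl measure0.
rewrite (ge0_negligible_integral (measurableC mW) mD mg g0 N0).
rewrite setDE setCK setIC (setIidl WD).
by apply: eq_measure_integral => A mA AW; rewrite /= /mrestr setIidl.
Qed.

Variable p : seq {set 'I_n}.
Hypothesis pW : forall y, weyl R (size p) y -> closed_weyl R n (@face_embed R n p y).

Lemma ge0_integral_face (g : 'rV[R]_n -> \bar R) :
  measurable_fun (closed_weyl R n) g -> (forall x, closed_weyl R n x -> 0 <= g x) ->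
  \int[face_measure p]_(x in closed_weyl R n) g x =
  \int[lebesgue_rV R (size p)]_(y in weyl R (size p)) g (face_embed y).
Proof.
move=> mg g0; have mE := @measurable_face_embed R n p.
pose nu := mrestr (lebesgue_rV R (size p)) (measurable_weyl R (size p)).
rewrite [LHS](@ge0_integral_pushforward _ _ _ _ R (@face_embed R n p) mE nu)//; last 2 first.
- exact: measurable_closed_weyl.
- by move=> x; rewrite inE; exact: g0.
have mEC : measurable (@face_embed R n p @^-1` closed_weyl R n).
  by rewrite -[X in measurable X]setTI; apply: mE => //; exact: measurable_closed_weyl.
rewrite ge0_integral_mrestr//.
- apply: (measurable_comp measurable_closed_weyl _ mg); first by move=> x [y ? <-].
  exact: measurable_funTS.
- by move=> y; exact: g0.
Qed.

End faces_integral.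

Section m_theta_integral.
Context {R : realType} (m : nat) (theta : R).
Hypothesis theta0 : 0 < theta.
Let n := m.+1.
Local Open Scope ereal_scope.

Lemma weight_gt0 p : p \in ordered_partitions n -> (0 < weight theta p)%R.
Proof.
move=> /partition_cutsK <-; rewrite weight_cut_partition /cut_weight.
rewrite mulr_gt0 ?exprz_gt0//; apply: prodr_gt0 => j _; rewrite invr_gt0 ltr0n.
apply/card_gt0P; have [|i ij] := @idx_surj _ (partition_cuts p) j; first by rewrite -ltnS.
by exists i; rewrite inE ij.
Qed.

(** [m_theta] is a bare set function, so a genuine measure and the formula for its integral are
    built together by induction over the list of partitions. *)
Lemma ge0_integral_m_theta (g : 'rV[R]_n -> \bar R) :
  measurable_fun (closed_weyl R n) g -> (forall x, closed_weyl R n x -> 0 <= g x) ->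
  \int[m_theta n theta]_(x in closed_weyl R n) g x =
  \sum_(p in ordered_partitions n) (weight theta p)%:E *
    \int[lebesgue_rV R (size p)]_(y in weyl R (size p)) g (face_embed y).
Proof.
move=> mg g0; have mW := @measurable_closed_weyl R n.
pose w (p : seq {set 'I_n}) := NngNum (weight_ge0 p theta0).
have H (s : seq (n.-bseq {set 'I_n})) : exists2 mu : {measure set 'rV[R]_n -> \bar R},
    (fun A => \sum_(p <- s) (weight theta p)%:E * face_measure p A) = mu &
    \int[mu]_(x in closed_weyl R n) g x = \sum_(p <- s) (weight theta p)%:E *
      \int[face_measure p]_(x in closed_weyl R n) g x.
  elim: s => [|p s [mu muE IH]].
    exists mzero; first by apply/funext => A; rewrite big_nil.
    by rewrite big_nil integral_measure_zero.
  exists (measure_add (mscale (w p) (face_measure p)) mu).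
    by apply/funext => A; rewrite [RHS]measure_addE big_cons -muE.
  by rewrite ge0_integral_measure_add// big_cons IH ge0_integral_mscale.
have [mu muE int_mu] := H (enum (ordered_partitions n)).
have -> : m_theta n theta = mu by rewrite -muE; apply/funext => A; rewrite /m_theta big_enum.
rewrite int_mu big_enum/=; apply: eq_bigr => p pp; congr (_ * _).
by apply: ge0_integral_face => // y /(face_embed_face pp) [].
Qed.

Variable f : 'rV[R]_n -> R.
Hypothesis intf : (m_theta n theta).-integrable (closed_weyl R n) (EFin \o f).

Lemma wintegrable_face p : p \in ordered_partitions n ->
  wintegrable (fun y : 'rV[R]_(size p) => f (face_embed y)).
Proof.
move=> pp; have [mu muE] := m_theta_measure n theta0.
have := intf; rewrite muE => /integrableP[mf]; rewrite -muE.
rewrite ge0_integral_m_theta//; last exact: measurableT_comp.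
move=> foo; apply/integrableP; split.
  apply: (measurable_comp (@measurable_closed_weyl R n) _ mf).
    by move=> x [y yW <-]; have [] := face_embed_face pp yW.
  by apply: measurable_funTS; exact: measurable_face_embed.
have w0 := weight_gt0 pp.
have : (weight theta p)%:E * \int[lebesgue_rV R (size p)]_(y in weyl R (size p))
    `|(f (face_embed y))%:E| < +oo.
  apply: le_lt_trans foo; rewrite (bigD1 p)//= leeDl//; apply: sume_ge0 => q /andP[qq _].
  by rewrite mule_ge0// ?lee_fin ?weight_ge0//; exact: integral_ge0.
(* An infinite face integral would stay infinite after multiplication by its weight, which is
   strictly positive. *)
by rewrite !ltey; apply: contra_neq => ->; rewrite gt0_muley.
Qed.

(** The nonnegative formula is applied to the positive and negative parts; both are finite on every
    face, so the subtraction takes place in R. *)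
Lemma integral_m_theta :
  \int[m_theta n theta]_(x in closed_weyl R n) (f x)%:E =
  (\sum_(p in ordered_partitions n) weight theta p *
     wint (fun y : 'rV[R]_(size p) => f (face_embed y)))%:E.
Proof.
have mf : measurable_fun (closed_weyl R n) (EFin \o f).
  have [mu muE] := m_theta_measure n theta0.
  by have := intf; rewrite muE => /integrableP[].
pose P (p : n.-bseq {set 'I_n}) :=
  \int[lebesgue_rV R (size p)]_(y in weyl R (size p)) ((EFin \o f)^\+ (@face_embed R n p y)).
pose N (p : n.-bseq {set 'I_n}) :=
  \int[lebesgue_rV R (size p)]_(y in weyl R (size p)) ((EFin \o f)^\- (@face_embed R n p y)).
have PN p : p \in ordered_partitions n ->
    [/\ P p \is a fin_num, N p \is a fin_num &
      (wint (fun y : 'rV[R]_(size p) => f (face_embed y)))%:E = P p - N p].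
  move=> pp; have ip := wintegrable_face pp; have mWp := measurable_weyl R (size p).
  pose fp := (EFin \o f) \o @face_embed R n p.
  have PE : P p = \int[lebesgue_rV R (size p)]_(y in weyl R (size p)) fp^\+ y.
    by apply: eq_integral => y _; rewrite !funeposE.
  have NE : N p = \int[lebesgue_rV R (size p)]_(y in weyl R (size p)) fp^\- y.
    by apply: eq_integral => y _; rewrite !funenegE.
  rewrite PE NE; split.
  - exact: (integrable_fin_num mWp (integrable_funepos mWp ip)).
  - exact: (integrable_fin_num mWp (integrable_funeneg mWp ip)).
  - by rewrite -wintE// integralE.
have [mu muE] := m_theta_measure n theta0.
rewrite muE [LHS]integralE -muE ge0_integral_m_theta//; last exact: measurable_funepos.
rewrite ge0_integral_m_theta//; last exact: measurable_funeneg.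
rewrite (eq_bigr (fun p : n.-bseq {set 'I_n} => (weight theta p * fine (P p))%:E)); last first.
  by move=> p /PN[Pp _ _]; rewrite [RHS]EFinM fineK.
rewrite [X in _ - X](eq_bigr (fun p : n.-bseq {set 'I_n} => (weight theta p * fine (N p))%:E)); last first.
  by move=> p /PN[_ Np _]; rewrite [RHS]EFinM fineK.
rewrite !sumEFin -EFinB -sumrB; congr EFin; apply: eq_bigr => p /PN[Pp Np E].
rewrite -mulrBr; congr (_ * _)%R; apply: EFin_inj.
by rewrite E EFinB !fineK.
Qed.

End m_theta_integral.

Section transport.
Context {R : realType} (m : nat).
Implicit Types S : {set 'I_m}.

(* face_embed with the dimension of its source decoupled from the length of p,
   which is only propositionally equal to #|S|.+1. *)
Definition block_embed (p : seq {set 'I_m.+1}) N (y : 'rV[R]_N) : 'rV[R]_m.+1 :=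
  \row_i \sum_(j < N | i \in nth finset.set0 p j) y 0 j.

Lemma block_embed_cut S : @block_embed (cut_partition S) #|S|.+1 = @emb R m S #|S|.
Proof.
apply/funext => y; apply/rowP => i; rewrite !mxE.
rewrite (big_pred1 (inord (idx S i))) // => j /=.
by rewrite nth_cut_partition// inE -val_eqE/= inord_idxE// eq_sym.
Qed.

(** Letting Q range over the dimension together with the map replaces a cast of row vectors along
    [size (cut_partition S) = #|S|.+1]. *)
Lemma face_embed_ind S (Q : forall N, ('rV[R]_N -> 'rV[R]_m.+1) -> Prop) :
  Q #|S|.+1 (@emb R m S #|S|) -> Q (size (cut_partition S)) (@face_embed R m.+1 (cut_partition S)).
Proof.
move=> QS; rewrite -[@face_embed _ _ _]/(@block_embed (cut_partition S) (size (cut_partition S))).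
by rewrite (size_mkseq _ _ : size (cut_partition S) = _) block_embed_cut.
Qed.

Lemma grad_on_face S (U : set 'rV[R]_m.+1) (f g : 'rV[R]_m.+1 -> R) (y : 'rV[R]_(#|S|).+1) :
  open U -> closed_weyl R m.+1 `<=` U -> C_on 1 U f -> C_on 1 U g -> weyl R _ y ->
  dot (grad (f \o @emb R m S #|S|) y) (grad (g \o @emb R m S #|S|) y) = dirichlet S f g y.
Proof.
move=> oU subU f1 g1 /weyl_sub yW; apply: eq_bigr => j _.
have Uy : U (emb S y) by apply: subU; exact: emb_closed_weyl.
rewrite !mxE; congr (_ * _).
  by have [_ <-] := is_derive_emb j erefl oU f1 Uy.
by have [_ <-] := is_derive_emb j erefl oU g1 Uy.
Qed.

End transport.

Unset Implicit Arguments.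

Theorem proposition3p8 (R : realType) (n : nat) (theta : R)
    (u v : 'rV[R]_n -> R) :
  (0 < n)%N -> 0 < theta ->
  D_theta theta u -> C1_b v ->
  (exists a c : R, [/\ 0 < a, 0 < c & forall x, closed_weyl R n x ->
     enorm (grad u x) <= a * expR (- c * enorm x)]) ->
  (m_theta n theta).-integrable (closed_weyl R n)
    (fun x => (laplacian u x * v x)%:E) ->
  (forall p, p \in ordered_partitions n ->
     (lebesgue_rV R (size p)).-integrable (weyl R (size p))
       (fun y => (dot (grad (on_face p u) y) (grad (on_face p v) y))%:E)) ->
  (\int[m_theta n theta]_(x in closed_weyl R n) (laplacian u x * v x)%:E
     = - theta_form theta u v)%E.
Proof.
case: n u v => [//|m] u v _ theta0 Du v1 [a [c [a0 c0 gradu]]] int_lap int_dir.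
have t0 : theta != 0 by rewrite gt_eqF.
have [[Uu [oUu subUu u2]] _ _ _] := Du.1.
have [[Uv [oUv subUv v1']] _] := v1.
pose U := Uu `&` Uv.
have oU : open U by exact: openI.
have subU : closed_weyl R m.+1 `<=` U by move=> x xW; split; [exact: subUu|exact: subUv].
have {}u1 : C_on 1 U u by apply: C_onS; apply: C_on_sub u2 => x [].
have {}v1' : C_on 1 U v by apply: C_on_sub v1' => x [].
have dotE (S : {set 'I_m}) y : weyl R _ y ->
    dot (grad (u \o @emb R m S #|S|) y) (grad (v \o @emb R m S #|S|) y) = dirichlet S u v y.
  exact: grad_on_face oU subU u1 v1'.
have lapS (S : {set 'I_m}) :
    wintegrable (fun y : 'rV[R]_(#|S|).+1 => laplacian u (emb S y) * v (emb S y)).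
  have := wintegrable_face theta0 int_lap (cut_partition_ordered S).
  (* The transported predicate is an implication towards the goal, so that the dimension changes in
     its premise. *)
  apply: (@face_embed_ind R m S (fun N e => wintegrable (fun y : 'rV[R]_N =>
    laplacian u (e y) * v (e y)) -> _)).
  by [].
have dirS (S : {set 'I_m}) : wintegrable (@dirichlet R m S #|S| u v).
  have := int_dir _ (cut_partition_ordered S).
  apply: (@face_embed_ind R m S (fun N e => wintegrable (fun y : 'rV[R]_N =>
    dot (grad (u \o e) y) (grad (v \o e) y)) -> _)).
  by apply: eq_wintegrable => y yW; exact: dotE.
rewrite (integral_m_theta theta0 int_lap) /theta_form.
rewrite (eq_bigr (fun p : m.+1.-bseq {set 'I_m.+1} => (weight theta p * wint (fun y : 'rV[R]_(size p) =>
    dot (grad (on_face p u) y) (grad (on_face p v) y)))%:E)); last first.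
  by move=> p pp; rewrite [RHS]EFinM wintE//; exact: int_dir.
rewrite sumEFin -EFinN; congr EFin; rewrite !sum_ordered_partitions.
have := identity_limit t0 Du v1 a0 c0 gradu lapS dirS.
congr (_ = - _); apply: eq_bigr => S _; rewrite weight_cut_partition; congr (_ * _).
  apply: (@face_embed_ind R m S (fun N e => _ = wint (fun y : 'rV[R]_N =>
    laplacian u (e y) * v (e y)))).
  by [].
apply: (@face_embed_ind R m S (fun N e => _ = wint (fun y : 'rV[R]_N =>
    dot (grad (u \o e) y) (grad (v \o e) y)))).
by apply: eq_wint => y yW; rewrite dotE.
Qed.
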